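(* Let $q\ge 1$ be an integer and let $N_1,N_2$ be random variables taking values in $\{0,1,\ldots,q\}$. For $\omega\ge 0$ define $$\mathcal I_1(\omega)=\{n\in\{1,\ldots,q\}:\ \overline F_{N_1}(n)-\omega\,\overline F_{N_2}(n)>0\},\qquad \mathcal I_2(\omega)=\{n\in\{1,\ldots,q\}:\ \overline F_{N_1}(n)-\omega\,\overline F_{N_2}(n)\le 0\}.$$ Then the capacity region (for private messages only) of the $q$-bit layered erasure broadcast channel $(N_1,N_2)$ equals the convex hull of the union over all $\omega\ge 0$ of the sets of rate pairs $(R_1,R_2)$, $R_1,R_2\ge 0$, satisfying $$R_1\le \sum_{n\in\mathcal I_1(\omega)}\overline F_{N_1}(n),\qquad R_2\le \sum_{n\in\mathcal I_2(\omega)}\overline F_{N_2}(n).$$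
   Context: Notation: $\overline F_N(n):=\Pr[N\ge n]$. Logarithms and rates are to the base 2 (rates in bits per channel use). The $q$-bit layered erasure broadcast channel $(N_1,N_2)$: in each channel use $t$ the transmitter sends a binary vector $X[t]=(X_1[t],\ldots,X_q[t])\in\{0,1\}^q$. For $i=1,2$, receiver $i$ has a channel state $N_i[t]$, where $(N_1[t],N_2[t])$, $t=1,2,\ldots$, is i.i.d. in time, independent of the messages and inputs, and $N_i[t]$ has the distribution of $N_i$. Receiver $i$ observes its state $N_i[t]$ together with the first $N_i[t]$ bits $Y_i[t]=(X_1[t],\ldots,X_{N_i[t]}[t])$; the bits $X_{N_i[t]+1}[t],\ldots,X_q[t]$ are erased. The transmitter does not know the channel states (it knows only their distributions) and there is no feedback. It is thus a two-receiver discrete memoryless broadcast channel. Capacity region: two independent private messages, uniform on sets of size $2^{\lceil TR_1\rceil}$ and $2^{\lceil TR_2\rceil}$, are encoded jointly into $T$ channel inputs; receiver $i$ decodes message $i$ from its $T$ observations (no common message). A pair $(R_1,R_2)$ is achievable if there are codes of length $T\to\infty$ with these rates whose error probabilities at both receivers tend to $0$; the capacity region is the closure of the set of achievable pairs. *)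

(* Defs.v *)
From HB Require Import structures.
From mathcomp Require Import all_boot all_order all_algebra.
From mathcomp Require Import all_classical all_reals all_analysis.
Set Implicit Arguments.
Unset Strict Implicit.
Unset Printing Implicit Defensive.
Import Order.TTheory GRing.Theory Num.Theory.
Import numFieldNormedType.Exports.
Local Open Scope classical_set_scope.
Local Open Scope ring_scope.

(* Throughout, [W x (y1, y2)] = Pr[Y1 = y1, Y2 = y2 | X = x]. *)

Record bc_code (X Y1 Y2 : finType) (T M1 M2 : nat) := BCCode {
  bc_enc : 'I_M1 -> 'I_M2 -> {ffun 'I_T -> X};
  bc_dec1 : {ffun 'I_T -> Y1} -> 'I_M1;
  bc_dec2 : {ffun 'I_T -> Y2} -> 'I_M2
}.

Definition memoryless (R : realType) (X Y1 Y2 : finType)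
    (W : X -> Y1 * Y2 -> R) (T : nat)
    (x : {ffun 'I_T -> X}) (y : {ffun 'I_T -> Y1 * Y2}) : R :=
  \prod_(t < T) W (x t) (y t).

(* The messages are independent and uniform; receiver i sees only the i-th
   components of the output block. *)
Definition bc_error1 (R : realType) (X Y1 Y2 : finType)
    (W : X -> Y1 * Y2 -> R) (T M1 M2 : nat)
    (c : bc_code X Y1 Y2 T M1 M2) : R :=
  (M1 * M2)%:R^-1 * \sum_(m1 < M1) \sum_(m2 < M2)
    \sum_(y : {ffun 'I_T -> Y1 * Y2} | bc_dec1 c [ffun t => (y t).1] != m1)
      memoryless W (bc_enc c m1 m2) y.

Definition bc_error2 (R : realType) (X Y1 Y2 : finType)
    (W : X -> Y1 * Y2 -> R) (T M1 M2 : nat)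
    (c : bc_code X Y1 Y2 T M1 M2) : R :=
  (M1 * M2)%:R^-1 * \sum_(m1 < M1) \sum_(m2 < M2)
    \sum_(y : {ffun 'I_T -> Y1 * Y2} | bc_dec2 c [ffun t => (y t).2] != m2)
      memoryless W (bc_enc c m1 m2) y.

(* Only used for [0 <= r], where [`| _ |] is just the cast from [int]. *)
Definition num_messages (R : realType) (T : nat) (r : R) : nat :=
  (2 ^ `|Num.ceil (T%:R * r)|)%N.

(* One code for every block length T. Rate pairs live in [R^o * R^o] so that they
   form an R-module, as [convex_set] requires; the topology is the usual one. *)
Definition bc_achievable (R : realType) (X Y1 Y2 : finType)
    (W : X -> Y1 * Y2 -> R) (r : R^o * R^o) : Prop :=
  [/\ 0 <= r.1, 0 <= r.2 &
   exists c : forall T : nat,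
       bc_code X Y1 Y2 T (num_messages T r.1) (num_messages T r.2),
     (bc_error1 W (c T) @[T --> \oo] --> (0 : R)) /\
     (bc_error2 W (c T) @[T --> \oo] --> (0 : R))].

Definition bc_capacity_region (R : realType) (X Y1 Y2 : finType)
    (W : X -> Y1 * Y2 -> R) : set (R^o * R^o) :=
  closure [set r | bc_achievable W r].

(* The state [n] is observed together with the first [n] bits, [None] marking
   an erasure. Bit [k] has 0-based index, hence [k < n]. For [n <= q], [inord n]
   is [n] itself. *)
Definition leb_observe (q n : nat) (x : {ffun 'I_q -> bool}) :
    'I_q.+1 * {ffun 'I_q -> option bool} :=
  (inord n, [ffun k : 'I_q => if (k < n)%N then Some (x k) else None]).

(* The states of one channel use are distributed as (N1, N2), whose joint law is
   arbitrary, whatever the input [x]. *)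
Definition leb_channel (R : realType) (d : measure_display)
    (Omega : measurableType d) (P : probability Omega R) (q : nat)
    (N1 N2 : {RV P >-> nat}) (x : {ffun 'I_q -> bool})
    (y : ('I_q.+1 * {ffun 'I_q -> option bool}) *
         ('I_q.+1 * {ffun 'I_q -> option bool})) : R :=
  fine (P [set w | (leb_observe (N1 w) x, leb_observe (N2 w) x) = y]).

Definition tail_prob (R : realType) (d : measure_display)
    (Omega : measurableType d) (P : probability Omega R)
    (N : {RV P >-> nat}) (n : nat) : R :=
  fine (P [set w | (n <= N w)%N]).

Definition layers1 (R : realType) (d : measure_display)
    (Omega : measurableType d) (P : probability Omega R) (q : nat)
    (N1 N2 : {RV P >-> nat}) (omega : R) : seq nat :=
  [seq n <- index_iota 1 q.+1 | tail_prob N1 n - omega * tail_prob N2 n > 0].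

Definition layers2 (R : realType) (d : measure_display)
    (Omega : measurableType d) (P : probability Omega R) (q : nat)
    (N1 N2 : {RV P >-> nat}) (omega : R) : seq nat :=
  [seq n <- index_iota 1 q.+1 | tail_prob N1 n - omega * tail_prob N2 n <= 0].

Definition layered_rates (R : realType) (d : measure_display)
    (Omega : measurableType d) (P : probability Omega R) (q : nat)
    (N1 N2 : {RV P >-> nat}) (omega : R) : set (R^o * R^o) :=
  [set r | [/\ 0 <= r.1, 0 <= r.2,
    r.1 <= \sum_(n <- layers1 q N1 N2 omega) tail_prob N1 n &
    r.2 <= \sum_(n <- layers2 q N1 N2 omega) tail_prob N2 n]].

Definition convex_hull (R : realType) (E : lmodType R) (A : set E) : set E :=
  smallest (fun C : set E => convex_set (C : set (convex_lmodType E))) A.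

(* Main.v *)
(** Converse. Uniform messages make all entropies averages of logarithms of fibre
    sizes. Given the states [n], receiver 1 sees the input on the cells
    [D1 = {(t, j) | j < n1 t}], receiver 2 on [D2]. With
    [h D = H(message 1, input on D)], Fano's inequality gives
    [log M1 + log M2 <~ E h(D2)] and [E h(D1) <~ E |D1| log 2], and for
    [0 <= w <= 1] submodularity of [h] gives
    [(1 - w) h(set0) + w E h(D2)
       <= E h(D1) + T log 2 * sum_j max(0, w F2(j) - F1(j))],
    hence [R1 + w R2 <= sum_j max(F1(j), w F2(j))]. Weights above 1 follow by
    exchanging the receivers. A pair satisfying all these inequalities lies below
    a segment joining two corners of the rectangles [layered_rates].

    Achievability. The hull is contained in the set of pairs dominated by
    [(sum_j a_j F1(j), sum_j (1 - a_j) F2(j))] for some [a_j] in [[0, 1]]; there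
    level [j] carries message 1 during a fraction [a_j] of the block and message 2
    afterwards, each with its own greedily chosen codebook. *)

Require Import Defs.
From HB Require Import structures.
From mathcomp Require Import all_boot all_order all_algebra.
From mathcomp Require Import all_classical all_reals all_analysis.
From mathcomp Require Import ring lra.
Set Implicit Arguments.
Unset Strict Implicit.
Unset Printing Implicit Defensive.
Import Order.TTheory GRing.Theory Num.Theory.
Import numFieldNormedType.Exports.
Local Open Scope classical_set_scope.
Local Open Scope ring_scope.

(** * Entropy of functions of a uniform variable *)

Section Entropy.
Variables (R : realType) (Om : finType).

Definition fibre_size (U : eqType) (f : Om -> U) (w : Om) : R :=
  #|[pred w' | f w' == f w]|%:R.

Definition pairf (U V : Type) (f : Om -> U) (g : Om -> V) (w : Om) := (f w, g w).

(* The Shannon entropy, in nats, of [f] at a uniformly distributed point. *)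
Definition entropy (U : eqType) (f : Om -> U) : R :=
  #|Om|%:R^-1 * \sum_w ln (#|Om|%:R / fibre_size f w).

Lemma fibre_size_gt0 (U : eqType) (f : Om -> U) w : 0 < fibre_size f w.
Proof. by rewrite ltr0n; apply/card_gt0P; exists w; rewrite inE. Qed.

Lemma eq_entropy (U V : eqType) (f : Om -> U) (g : Om -> V) :
  (forall w w', (f w' == f w) = (g w' == g w)) -> entropy f = entropy g.
Proof.
move=> fg; congr (_ * _); apply: eq_bigr => w _; congr (ln (_ / _%:R)).
by apply: eq_card => w'; rewrite !inE fg.
Qed.

(** The ratio of fibre sizes is the inverse conditional probability of [g w] given [f w], so it
    cancels the frequency of each value of [g]. Values that [g] never takes on a fibre of [f] are
    lost, whence only an inequality. *)
Lemma sum_fibre_weight (U : eqType) (V : finType) (f : Om -> U) (g : Om -> V)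
    (c : Om -> V -> R) :
  (forall w v, 0 <= c w v) ->
  (forall w w' v, f w = f w' -> c w v = c w' v) ->
  \sum_w fibre_size f w / fibre_size (pairf f g) w * c w (g w)
    <= \sum_w \sum_v c w v.
Proof.
move=> c0 cE.
have -> : \sum_w fibre_size f w / fibre_size (pairf f g) w * c w (g w) =
   \sum_w \sum_(w' | f w' == f w) c w (g w) / fibre_size (pairf f g) w.
  by apply: eq_bigr => w _; rewrite sumr_const -mulr_natl mulrAC -mulrA.
rewrite (exchange_big_dep predT) //=; apply: ler_sum => w' _.
rewrite (partition_big g predT) //=; apply: ler_sum => v _.
set k := #|[pred w | (f w' == f w) && (g w == v)]|.
rewrite (eq_bigr (fun=> c w' v / k%:R)) => [|w /andP[/eqP fw /eqP gw]].
  rewrite sumr_const -/k -[leLHS]mulr_natl.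
  have [->|k0] := eqVneq k 0%N; first by rewrite mul0r.
  by rewrite mulrC mulfVK // pnatr_eq0.
rewrite gw (cE _ _ _ fw); congr (_ / _%:R); apply: eq_card => w2.
by rewrite !inE xpair_eqE gw fw (eq_sym (f w2)).
Qed.

(** Gibbs' inequality, from [ln x <= x - 1]: [c w] is a guess, possibly unnormalised, at the
    conditional law of [g] given [f], and the excess of its mass over 1 is charged. Suitable choices
    of [c] give the bit bound, submodularity and Fano's inequality. *)
Lemma entropy_pair_le (U : eqType) (V : finType) (f : Om -> U) (g : Om -> V)
    (c : Om -> V -> R) :
  (forall w v, 0 <= c w v) -> (forall w, 0 < c w (g w)) ->
  (forall w w' v, f w = f w' -> c w v = c w' v) ->
  entropy (pairf f g) <= entropy f +
    #|Om|%:R^-1 * \sum_w (\sum_v c w v - 1 - ln (c w (g w))).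
Proof.
move=> c0 cg0 cE; rewrite -mulrDr ler_wpM2l ?invr_ge0 //.
rewrite -lerBlDl -sumrB.
have L w : ln (#|Om|%:R / fibre_size (pairf f g) w) -
    (ln (#|Om|%:R / fibre_size f w)) <=
    (fibre_size f w / fibre_size (pairf f g) w * c w (g w) - 1 -
       ln (c w (g w)) : R).
  have card0 : 0 < #|Om|%:R :> R by rewrite ltr0n; apply/card_gt0P; exists w.
  have f0 := fibre_size_gt0 f w; have g0 := fibre_size_gt0 (pairf f g) w.
  have -> : ln (#|Om|%:R / fibre_size (pairf f g) w) -
     ln (#|Om|%:R / fibre_size f w) =
     ln (fibre_size f w / fibre_size (pairf f g) w * c w (g w)) - ln (c w (g w)).
    rewrite !(lnM, lnV) ?posrE ?divr_gt0 ?invr_gt0 //; ring.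
  rewrite lerD2r; set x := (_ / _ * _); have x0 : 0 < x by rewrite mulr_gt0 ?divr_gt0.
  have e : x = 1 + (x - 1) by rewrite addrCA subrr addr0.
  by rewrite {1}e le_ln1Dx // ltrBrDl subrr.
apply: (@le_trans _ _ (\sum_w (fibre_size f w / fibre_size (pairf f g) w * c w (g w) - 1 -
       ln (c w (g w))))).
  by apply: ler_sum => w _; exact: L.
by rewrite !sumrB !lerD2r; exact: sum_fibre_weight.
Qed.

Lemma entropy_bit_le (U : eqType) (f : Om -> U) (b : Om -> bool) :
  entropy (pairf f b) <= entropy f + ln 2.
Proof.
apply: (le_trans (@entropy_pair_le _ _ f b (fun _ _ => 2^-1) _ _ _)) => //.
have half2 : 2^-1 + 2^-1 = 1 :> R by lra.
rewrite lerD2l big_bool /= half2 subrr sub0r lnV ?posrE // opprK.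
have [->|card0] := eqVneq #|Om| 0%N; first by rewrite invr0 mul0r ln_ge0 // ler1n.
by rewrite sumr_const -[X in _ * X]mulr_natl mulrA mulVf ?mul1r // pnatr_eq0.
Qed.

Lemma entropy_pair_ge (U V : eqType) (f : Om -> U) (g : Om -> V) :
  entropy f <= entropy (pairf f g).
Proof.
rewrite ler_wpM2l ?invr_ge0 //; apply: ler_sum => w _.
have card0 : 0 < #|Om|%:R :> R by rewrite ltr0n; apply/card_gt0P; exists w.
have f0 := fibre_size_gt0 f w; have g0 := fibre_size_gt0 (pairf f g) w.
rewrite ler_ln ?posrE ?divr_gt0 // ler_wpM2l // lef_pV2 ?posrE // ler_nat.
by apply: subset_leq_card; apply/fintype.subsetP => w'; rewrite !inE xpair_eqE => /andP[].
Qed.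

(** Conditioning on the finer [f'] leaves no more uncertainty about [g] than conditioning on [f]:
    the true conditional law given [f] serves as the guess for the one given [f']. *)
Lemma entropy_submodular (U U' : eqType) (V : finType) (f : Om -> U)
    (f' : Om -> U') (g : Om -> V) :
  (forall w w', f' w = f' w' -> f w = f w') ->
  entropy (pairf f' g) + entropy f <= entropy f' + entropy (pairf f g).
Proof.
move=> f'f.
pose c w v := #|[pred w' | (f w' == f w) && (g w' == v)]|%:R / fibre_size f w.
apply: (le_trans (lerD (@entropy_pair_le _ _ f' g c _ _ _) (lexx _))).
- by move=> w v; rewrite divr_ge0.
- move=> w; rewrite divr_gt0 ?fibre_size_gt0 // ltr0n.
  by apply/card_gt0P; exists w; rewrite !inE !eqxx.
- by move=> w w' v /f'f fw; rewrite /c /fibre_size fw.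
rewrite -addrA lerD2l -lerBrDr -mulrBr ler_wpM2l ?invr_ge0 // -sumrB.
apply: ler_sum => w _.
have card0 : 0 < #|Om|%:R :> R by rewrite ltr0n; apply/card_gt0P; exists w.
have f0 := fibre_size_gt0 f w; have g0 := fibre_size_gt0 (pairf f g) w.
have -> : c w (g w) = fibre_size (pairf f g) w / fibre_size f w.
  by congr (_%:R / _); apply: eq_card => w'; rewrite !inE xpair_eqE.
have -> : \sum_v c w v = 1.
  rewrite -mulr_suml; apply: (canLR (mulfK _)); first by rewrite gt_eqF.
  rewrite mul1r -natr_sum; congr _%:R; rewrite -sum1_card (partition_big g predT) //=.
  by apply: eq_bigr => v _; rewrite -sum1_card; apply: eq_bigl => w'; rewrite !inE.
rewrite !ln_div ?posrE //; lra.
Qed.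

Lemma fano (U : eqType) (V : finType) (f : Om -> U) (g dec : Om -> V) :
  (forall w w', f w = f w' -> dec w = dec w') ->
  entropy (pairf f g) <= entropy f + 1 +
    #|Om|%:R^-1 * #|[pred w | dec w != g w]|%:R * ln #|V|%:R.
Proof.
move=> decE.
have [card0|card0] := eqVneq #|Om| 0%N.
  by rewrite /entropy card0 invr0 !mul0r addr0 add0r ler01.
have V0 (w : Om) : 0 < #|V|%:R :> R by rewrite ltr0n; apply/card_gt0P; exists (g w).
(* The guess puts 1 on the decoded value and [#|V|^-1] on every other one. Its mass is below 2,
   which gives the additive 1, and its logarithm costs [ln #|V|] at the errors only. *)
pose c w v : R := if v == dec w then 1 else #|V|%:R^-1.
apply: (le_trans (@entropy_pair_le _ _ f g c _ _ _)).
- by move=> w v; rewrite /c; case: ifP; rewrite ?invr_ge0.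
- by move=> w; rewrite /c; case: ifP; rewrite ?invr_gt0 ?V0.
- by move=> w w' v /decE e; rewrite /c e.
rewrite -addrA lerD2l.
rewrite -[X in _ <= X + _](_ : #|Om|%:R^-1 * \sum_(w : Om) 1 = 1); last first.
  by rewrite sumr_const mulVf // pnatr_eq0.
rewrite -mulrA (_ : #|[pred w | dec w != g w]|%:R * ln #|V|%:R =
          \sum_w (dec w != g w)%:R * ln #|V|%:R :> R); last first.
  by rewrite -mulr_suml -natr_sum -sum1_card big_mkcond.
rewrite -mulrDr ler_wpM2l ?invr_ge0 // -big_split /=; apply: ler_sum => w _.
have V1 : 1 <= #|V|%:R :> R by rewrite ler1n -(ltr0n R) (V0 w).
apply: lerD.
  rewrite lerBlDr (bigD1 (dec w)) //= {1}/c eqxx lerD2l.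
  rewrite (eq_bigr (fun=> #|V|%:R^-1)) => [|v /negbTE vd]; last by rewrite /c vd.
  rewrite sumr_const -[leLHS]mulr_natl ler_pdivrMr ?V0 // mul1r ler_nat.
  exact: max_card.
by rewrite /c eq_sym; case: eqP => _; rewrite ?ln1 ?oppr0 ?mul0r ?mul1r // lnV ?posrE ?V0 // opprK.
Qed.

Lemma entropy_ge (U : eqType) (f : Om -> U) (k : nat) :
  (forall w, #|[pred w' | f w' == f w]| <= k)%N ->
  (0 < #|Om|)%N -> ln (#|Om|%:R / k%:R) <= entropy f.
Proof.
move=> fk card0; rewrite -[leLHS](mulKf (_ : #|Om|%:R != 0)) ?pnatr_eq0 -?lt0n //.
rewrite ler_wpM2l ?invr_ge0 // mulr_natl -sumr_const; apply: ler_sum => w _.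
have f0 := fibre_size_gt0 f w.
have k0 : (0 < k)%N by rewrite (leq_trans _ (fk w)) // -(ltr0n R).
move: card0 k0; rewrite -2!(ltr0n R) => card0 k0.
by rewrite ler_ln ?posrE ?divr_gt0 // ler_wpM2l // lef_pV2 ?posrE // ler_nat fk.
Qed.

End Entropy.

(** * Means over independent states *)

Section ProductExpectation.
Variables (R : realType) (T q : nat).
Implicit Types (n : {ffun 'I_T -> 'I_q.+1}) (nu : 'I_T -> 'I_q.+1 -> R)
  (p : 'I_q.+1 -> R) (t : 'I_T).

Definition prob_dist p := (forall k, 0 <= p k) /\ \sum_k p k = 1.

Definition product_mean nu (phi : {ffun 'I_T -> 'I_q.+1} -> R) : R :=
  \sum_(n : {ffun 'I_T -> 'I_q.+1}) (\prod_t nu t (n t)) * phi n.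

Definition update n t (k : 'I_q.+1) : {ffun 'I_T -> 'I_q.+1} :=
  [ffun u => if u == t then k else n u].

(** The condition [n t == ord0] picks one representative of each class of vectors that differ only
    at [t]; the inner sum runs through the class. *)
Lemma sum_update (G : {ffun 'I_T -> 'I_q.+1} -> R) t :
  \sum_n G n = \sum_(n : {ffun 'I_T -> 'I_q.+1} | n t == ord0) \sum_k G (update n t k).
Proof.
rewrite (partition_big (fun n : {ffun 'I_T -> 'I_q.+1} => update n t ord0)
  (fun n : {ffun 'I_T -> 'I_q.+1} => n t == ord0)) /=;
  last by move=> n _; rewrite ffunE eqxx.
apply: eq_bigr => n /eqP n0.
rewrite (reindex_onto (update n t) (fun n' : {ffun 'I_T -> 'I_q.+1} => n' t)) /=.
  apply: eq_bigl => k; rewrite ffunE !eqxx andbT; apply/eqP/ffunP => u.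
  by rewrite !ffunE; case: eqP => // ->.
move=> n' /eqP <-; apply/ffunP => u; rewrite !ffunE.
by case: eqP => // ->.
Qed.

Lemma prod_update nu n t k :
  \prod_u nu u (update n t k u) = nu t k * \prod_(u | u != t) nu u (n u).
Proof.
rewrite (bigD1 t) //= ffunE eqxx; congr (_ * _); apply: eq_bigr => u /negbTE ut.
by rewrite ffunE ut.
Qed.

Lemma product_mean_cst nu c : (forall t, prob_dist (nu t)) ->
  product_mean nu (fun=> c) = c.
Proof.
move=> nuP; rewrite /product_mean -mulr_suml -bigA_distr_bigA /= big1 ?mul1r //.
by move=> t _; case: (nuP t).
Qed.

Lemma product_meanD nu phi psi :
  product_mean nu (fun n => phi n + psi n) =
  product_mean nu phi + product_mean nu psi.
Proof. by rewrite -big_split; apply: eq_bigr => n _; rewrite mulrDr. Qed.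

Lemma product_meanZ nu c phi :
  product_mean nu (fun n => c * phi n) = c * product_mean nu phi.
Proof. by rewrite mulr_sumr; apply: eq_bigr => n _; rewrite mulrCA. Qed.

Lemma ler_product_mean nu phi psi : (forall t, prob_dist (nu t)) ->
  (forall n, phi n <= psi n) -> product_mean nu phi <= product_mean nu psi.
Proof.
move=> nuP le; apply: ler_sum => n _; rewrite ler_wpM2l // prodr_ge0 // => t _.
by case: (nuP t).
Qed.

(** Condition on all coordinates but [t]: there the two product laws coincide, so comparing the
    means over coordinate [t] is enough. *)
Lemma product_mean_coord nu nu' phi phi' t C :
  (forall u, prob_dist (nu u)) -> (forall u, prob_dist (nu' u)) ->
  (forall u, u != t -> nu u =1 nu' u) ->
  (forall n, \sum_k nu t k * phi (update n t k) <=
             \sum_k nu' t k * phi' (update n t k) + C) ->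
  product_mean nu phi <= product_mean nu' phi' + C.
Proof.
move=> nuP nuP' nunu' le; rewrite -[C](product_mean_cst C nuP') -product_meanD.
rewrite /product_mean (sum_update _ t) [leRHS](sum_update _ t); apply: ler_sum => n _.
pose w := \prod_(u | u != t) nu u (n u).
have wE : \prod_(u | u != t) nu' u (n u) = w.
  by apply: eq_bigr => u ut; rewrite nunu'.
under eq_bigr do rewrite prod_update -/w mulrAC mulrC.
under [leRHS]eq_bigr do rewrite prod_update wE mulrAC mulrC mulrDr.
rewrite -!mulr_sumr ler_wpM2l ?prodr_ge0 // => [u _|]; first by case: (nuP u).
rewrite big_split /= -mulr_suml; case: (nuP' t) => _ ->; rewrite mul1r; exact: le.
Qed.

Lemma product_mean_prod nu (g : 'I_T -> 'I_q.+1 -> R) :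
  product_mean nu (fun n => \prod_t g t (n t)) = \prod_t \sum_k nu t k * g t k.
Proof.
by rewrite bigA_distr_bigA; apply: eq_bigr => n _; rewrite -big_split.
Qed.

Lemma product_mean_marginal nu t (g : 'I_q.+1 -> R) :
  (forall u, prob_dist (nu u)) ->
  product_mean nu (fun n => g (n t)) = \sum_k nu t k * g k.
Proof.
move=> nuP; pose g' u k := if u == t then g k else 1.
rewrite (_ : product_mean nu _ = product_mean nu (fun n => \prod_u g' u (n u))).
  rewrite product_mean_prod (bigD1 t) //= [X in _ * X]big1 ?mulr1 /g' ?eqxx //.
  move=> u /negbTE ->; under eq_bigr do rewrite mulr1; by case: (nuP u).
apply: eq_bigr => n _; congr (_ * _); rewrite (bigD1 t) //= [X in _ * X]big1 /g' ?eqxx ?mulr1 //.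
by move=> u /negbTE ->.
Qed.

Lemma product_mean_sum (I : Type) (s : seq I) (Q : pred I) nu phi :
  product_mean nu (fun n => \sum_(i <- s | Q i) phi i n) =
  \sum_(i <- s | Q i) product_mean nu (phi i).
Proof.
rewrite /product_mean exchange_big /=.
by apply: eq_bigr => n _; rewrite mulr_sumr.
Qed.

Definition tail p (j : nat) : R := \sum_(k < q.+1 | (j <= k)%N) p k.

Lemma tail_ge0 p j : prob_dist p -> 0 <= tail p j.
Proof. by move=> [p0 _]; apply: sumr_ge0. Qed.

(** Summation by parts: the mean is rewritten through increments of [b], the form in which
    monotonicity and submodularity apply. *)
Lemma sum_by_tails p (b : nat -> R) : prob_dist p ->
  \sum_(k < q.+1) p k * b k = b 0%N + \sum_(j < q) tail p j.+1 * (b j.+1 - b j).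
Proof.
move=> [_ p1].
have bE (k : 'I_q.+1) : b k = b 0%N + \sum_(j < q | (j < k)%N) (b j.+1 - b j).
  have kq : (k <= q)%N := leq_ord k.
  rewrite -(@big_ord_widen _ _ _ k q (fun j => b j.+1 - b j) kq).
  rewrite -(big_mkord xpredT (fun j => b j.+1 - b j)) telescope_sumr //.
  by rewrite addrC subrK.
under eq_bigr do rewrite bE mulrDr mulr_sumr.
rewrite big_split /= -mulr_suml p1 mul1r; congr (_ + _).
rewrite (exchange_big_dep predT) //=; apply: eq_bigr => j _.
by rewrite mulr_suml.
Qed.

Definition cells n : {set 'I_T * 'I_q} := [set c : 'I_T * 'I_q | (c.2 < n c.1)%N].

Lemma mean_card_cells p (A : {set 'I_T * 'I_q}) : prob_dist p ->
  product_mean (fun=> p) (fun n => #|A :&: cells n|%:R) =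
  \sum_(c in A) tail p c.2.+1.
Proof.
move=> pP; transitivity (product_mean (fun=> p) (fun n =>
    \sum_(c in A) (c.2 < n c.1)%:R)).
  apply: eq_bigr => n _; congr (_ * _).
  rewrite -sum1_card natr_sum [LHS]big_mkcond [RHS]big_mkcond /=.
  by apply: eq_bigr => c _; rewrite !inE; case: (c \in A); case: (_ < _)%N.
rewrite product_mean_sum; apply: eq_bigr => c _.
rewrite (@product_mean_marginal _ _ (fun k => (c.2 < k)%:R)) // /tail [RHS]big_mkcond.
by apply: eq_bigr => k _; case: (_ < _)%N; rewrite ?mulr1 ?mulr0.
Qed.

(** * Comparison of two state laws through a submodular set function *)

Section Hybrid.
Variables (h : {set 'I_T * 'I_q} -> R) (L : R).
Hypothesis h_mono : forall c A, h A <= h (c |: A).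
Hypothesis h_slope : forall c A, h (c |: A) <= h A + L.
Hypothesis h_sub : forall c (A B : {set 'I_T * 'I_q}), A \subset B ->
  h (c |: B) + h A <= h B + h (c |: A).

Let level t (k : nat) : {set 'I_T * 'I_q} := [set c : 'I_T * 'I_q | (c.1 == t) && (c.2 < k)%N].

Let levelS t (k : 'I_q) : level t k.+1 = (t, k) |: level t k.
Proof.
apply/setP => -[u j]; rewrite !inE ltnS leq_eqVlt xpair_eqE.
by case: (u == t).
Qed.

Let cells_before (j : nat) n : {set 'I_T * 'I_q} :=
  [set c in cells n | (c.1 < j)%N].

(* Coordinates before [j] follow [p1], the others [p2]; the weight [1 - w] goes
   to the cells before [j] only. Passing from [j] to [j.+1] is a one-coordinate
   comparison, where submodularity bounds the increments of the second summand
   by those of the first. *)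
Lemma hybrid_inequality (p1 p2 : 'I_q.+1 -> R) (w : R) :
  prob_dist p1 -> prob_dist p2 -> 0 <= w <= 1 ->
  (1 - w) * h finset.set0 + w * product_mean (fun=> p2) (fun n => h (cells n)) <=
  product_mean (fun=> p1) (fun n => h (cells n)) +
    T%:R * (L * \sum_(j < q) Num.max 0 (w * tail p2 j.+1 - tail p1 j.+1)).
Proof.
move=> p1P p2P /andP[w0 w1]; set C := L * _.
pose nu (j : nat) (u : 'I_T) := if (u < j)%N then p1 else p2.
pose phi (j : nat) n := (1 - w) * h (cells_before j n) + w * h (cells n).
have nuP j u : prob_dist (nu j u) by rewrite /nu; case: ifP.
have step j : (j < T)%N ->
    product_mean (nu j) (phi j) <= product_mean (nu j.+1) (phi j.+1) + C.
  move=> jT; pose t := Ordinal jT; apply: (@product_mean_coord _ _ _ _ t) => //.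
    move=> u ut k; rewrite /nu (_ : (u < j.+1)%N = (u < j)%N) //.
    by rewrite ltnS leq_eqVlt (negbTE (ut : (u : nat) != j)).
  move=> n; rewrite /nu /= ltnn ltnSn.
  (* [A] holds the surviving cells of the slots before [t], [B] those of all slots other than [t].
     Since [A \subset B], adding a cell of slot [t] to [B] gains no more than adding it to [A]. *)
  pose A := cells_before j n; pose B := cells (update n t ord0).
  pose a k := h (A :|: level t k); pose b k := h (B :|: level t k).
  have level0 : level t 0%N = finset.set0 by apply/setP => c; rewrite !inE ltn0 andbF.
  have AB : A \subset B.
    apply/fintype.subsetP => c; rewrite !inE ffunE => /andP[cn cj].
    by case: eqP cj => [->|]; rewrite ?ltnn.
  have phi0 (k : 'I_q.+1) : phi j (update n t k) = (1 - w) * h A + w * b k.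
    congr (_ * h _ + _ * h _); apply/setP => c; rewrite !inE !ffunE; case: eqP => //=.
      by move=> ->; rewrite ltnn !andbF.
    by rewrite orbF.
  have phi1 (k : 'I_q.+1) :
      phi j.+1 (update n t k) = (1 - w) * a k + w * b k.
    congr (_ * h _ + _ * h _); apply/setP => c; rewrite !inE !ffunE; case: eqP => //=.
    - by move=> ->; rewrite ltnn ltnSn !andbF andbT.
    - move=> /eqP ct; rewrite orbF (_ : (c.1 < j.+1)%N = (c.1 < j)%N) //.
      by rewrite ltnS leq_eqVlt (negbTE (ct : (c.1 : nat) != j)).
    - by rewrite orbF.
  under eq_bigr do rewrite phi0.
  under [in leRHS]eq_bigr do rewrite phi1.
  rewrite (sum_by_tails (fun k => (1 - w) * h A + w * b k)) //.
  rewrite (sum_by_tails (fun k => (1 - w) * a k + w * b k)) //.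
  have a0 : a 0%N = h A by rewrite /a level0 finset.setU0.
  rewrite a0 -[leRHS]addrA lerD2l /C mulr_sumr -big_split /=.
  apply: ler_sum => i _.
  have F1 := tail_ge0 i.+1 p1P; have F2 := tail_ge0 i.+1 p2P.
  move: (tail p1 i.+1) (tail p2 i.+1) F1 F2 => F1 F2 F10 F20.
  have [aS bS] : a i.+1 = h ((t, i) |: (A :|: level t i)) /\
                 b i.+1 = h ((t, i) |: (B :|: level t i)).
    by rewrite /a /b levelS !finset.setUA ![_ |: A]finset.setUC ![_ |: B]finset.setUC.
  have db0 : b i <= b i.+1 by rewrite bS h_mono.
  have dbL : b i.+1 <= b i + L by rewrite bS h_slope.
  have dab : b i.+1 + a i <= b i + a i.+1 by rewrite aS bS h_sub // finset.setSU.
  have L0 : 0 <= L by lra.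
  (* Submodularity lets the increment of [a] be replaced by the smaller one of [b]. What remains is
     a multiple of the latter, which lies between 0 and [L]. *)
  have F1a : 0 <= F1 * (1 - w) * ((a i.+1 - a i) - (b i.+1 - b i)).
    by rewrite !mulr_ge0 //; lra.
  have M : (w * F2 - F1) * (b i.+1 - b i) <= L * Num.max 0 (w * F2 - F1).
    have [le0|gt0] := leP (w * F2 - F1) 0.
      rewrite mulr0; apply: mulr_le0_ge0 => //; lra.
    by rewrite mulrC ler_wpM2r //; lra.
  move: F1a M; set m := Num.max _ _; lra.
have all j : (j <= T)%N ->
    product_mean (nu 0%N) (phi 0%N) <= product_mean (nu j) (phi j) + j%:R * C.
  elim: j => [|j IH] jT; first by rewrite mul0r addr0.
  apply: (le_trans (IH (ltnW jT))); rewrite -natr1 mulrDl mul1r addrA addrAC lerD2r.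
  exact: step.
have := all T (leqnn T).
have -> : product_mean (nu 0%N) (phi 0%N) =
    (1 - w) * h finset.set0 + w * product_mean (fun=> p2) (fun n => h (cells n)).
  rewrite product_meanD !product_meanZ; congr (_ * _ + _).
  rewrite -[RHS](@product_mean_cst (fun=> p2)) //; apply: eq_bigr => n _.
  by congr (_ * h _); apply/setP => c; rewrite !inE andbF.
have -> // : product_mean (nu T) (phi T) =
    product_mean (fun=> p1) (fun n => h (cells n)).
apply: eq_bigr => n _; congr (_ * _).
  by apply: eq_bigr => t _; rewrite /nu ltn_ord.
rewrite /phi; have -> : cells_before T n = cells n.
  by apply/setP => c; rewrite !inE ltn_ord andbT.
by rewrite -mulrDl subrK mul1r.
Qed.
End Hybrid.

End ProductExpectation.

(** * Reduction of the error probabilities to the marginal states *)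

(** Image of a product measure under coordinatewise maps: group the outcomes by their image and
    distribute the product over the sums. *)
Lemma sum_prod_push (R : comNzRingType) (I J K : finType) (alpha : I -> J -> R)
    (phi : I -> J -> K) (G : {ffun I -> K} -> R) :
  \sum_(y : {ffun I -> J}) (\prod_t alpha t (y t)) * G [ffun t => phi t (y t)] =
  \sum_(k : {ffun I -> K}) (\prod_t \sum_(j | phi t j == k t) alpha t j) * G k.
Proof.
rewrite (partition_big (fun y : {ffun I -> J} => [ffun t => phi t (y t)]) predT) //=.
apply: eq_bigr => k _; rewrite (bigA_distr_big_dep (fun t j => phi t j == k t)) mulr_suml.
apply: eq_big => [y|y /eqP <- //]; apply/eqP/familyP => [<- t|yk].
  by rewrite unfold_in ffunE.
by apply/ffunP => t; rewrite ffunE; apply/eqP; have := yk t; rewrite unfold_in.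
Qed.

Section Channel.
Variables (R : realType) (d : measure_display) (Omega : measurableType d)
  (P : probability Omega R) (q : nat).
Implicit Types N : {RV P >-> nat}.

Lemma measurable_states N1 N2 (S : nat -> nat -> Prop) :
  measurable [set w | S (N1 w) (N2 w)].
Proof.
have -> : [set w | S (N1 w) (N2 w)] = \bigcup_a \bigcup_(b in [set b | S a b])
    (N1 @^-1` [set a] `&` N2 @^-1` [set b]).
  apply/seteqP; split => [w Sw|w [a _ [b /= Sab [/= ea eb]]]].
    by exists (N1 w) => //; exists (N2 w).
  by rewrite ea eb.
apply: bigcupT_measurable => a; apply: bigcup_measurable => b _.
by apply: measurableI; apply: measurable_funPTI.
Qed.

Lemma prob_fin_fibres (J : finType) (Z : Omega -> J) (Q : pred J) :
  (forall j, measurable [set w | Z w = j]) ->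
  fine (P [set w | Q (Z w)]) = \sum_(j | Q j) fine (P [set w | Z w = j]).
Proof.
move=> mZ.
have -> : [set w | Q (Z w)] = \bigcup_(j in [set` Q]) [set w | Z w = j].
  apply/seteqP; split => [w Qw|w [j /= Qj ej]]; first by exists (Z w).
  by rewrite /= ej.
rewrite measure_fin_bigcup //; last first.
  by move=> i j _ _ [w [/= ei ej]]; exact: etrans (esym ei) ej.
rewrite -(bigfs _ (index_enum_uniq J)) => [|j _]; last by rewrite mem_index_enum.
rewrite (eq_bigr (fun j => (fine (P [set w | Z w = j]))%:E)) ?sumEFin // => j _.
by rewrite fineK // fin_num_measure.
Qed.

Definition law N (k : 'I_q.+1) : R := fine (P [set w | N w = k]).

Lemma lawE N (hN : forall w, (N w <= q)%N) (Q : pred nat) :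
  fine (P [set w | Q (N w)]) = \sum_(k < q.+1 | Q k) law N k.
Proof.
have inN w : (inord (N w) : 'I_q.+1) = N w :> nat by rewrite inordK // ltnS.
have -> : [set w | Q (N w)] = [set w | Q (inord (N w) : 'I_q.+1)].
  by apply/seteqP; split => w /=; rewrite inN.
rewrite (@prob_fin_fibres _ (fun w => inord (N w) : 'I_q.+1) (fun k => Q k)) //.
  apply: eq_bigr => k _; congr (fine (P _)); apply/seteqP; split => w /=.
    by move=> <-; rewrite inN.
  by move=> Nk; apply: val_inj; rewrite /= inN.
by move=> k; exact: (measurable_states N N (fun a _ => inord a = k)).
Qed.

Lemma law_dist N : (forall w, (N w <= q)%N) -> prob_dist (law N).
Proof.
move=> hN; split=> [k|]; first by rewrite fine_ge0.
rewrite -(lawE hN xpredT); have -> : [set w | true] = [set: Omega] by apply/seteqP.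
by rewrite probability_setT.
Qed.

Lemma tail_law N j : (forall w, (N w <= q)%N) -> tail (law N) j = tail_prob N j.
Proof. by move=> hN; rewrite /tail -(lawE hN (fun k => j <= k)%N). Qed.

Definition observe_block (T : nat) (n : {ffun 'I_T -> 'I_q.+1})
    (x : {ffun 'I_T -> {ffun 'I_q -> bool}}) :=
  [ffun t => leb_observe (n t) (x t)].

Lemma leb_channel_marginal N1 N2 (x : {ffun 'I_q -> bool}) y1 : (forall w, (N1 w <= q)%N) ->
  \sum_(y | y.1 == y1) leb_channel N1 N2 x y =
  \sum_(k < q.+1 | leb_observe k x == y1) law N1 k.
Proof.
move=> hN1; rewrite -(lawE hN1 (fun k => leb_observe k x == y1)).
rewrite -(@prob_fin_fibres _ (fun w => (leb_observe (N1 w) x, leb_observe (N2 w) x))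
  (fun y => y.1 == y1)) // => y.
exact: (measurable_states N1 N2 (fun a b => (leb_observe a x, leb_observe b x) = y)).
Qed.

(** Receiver 1 sees only [y.1]; summing out [y.2] leaves a mean over the law of [N1] alone, and the
    dependence between the two states disappears. *)
Lemma sum_memoryless_fst N1 N2 T (x : {ffun 'I_T -> {ffun 'I_q -> bool}})
    (G : {ffun 'I_T -> 'I_q.+1 * {ffun 'I_q -> option bool}} -> R) :
  (forall w, (N1 w <= q)%N) ->
  \sum_y memoryless (leb_channel N1 N2) x y * G [ffun t => (y t).1] =
  product_mean (fun=> law N1) (fun n => G (observe_block n x)).
Proof.
move=> hN1; rewrite (sum_prod_push (fun t => leb_channel N1 N2 (x t)) (fun _ y => y.1)).
rewrite /product_mean /observe_block.
rewrite (sum_prod_push (fun _ => law N1) (fun t k => leb_observe k (x t))).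
apply: eq_bigr => y _; congr (_ * _); apply: eq_bigr => t _.
exact: leb_channel_marginal.
Qed.

Lemma bc_error1E N1 N2 T M1 M2 (c : bc_code _ _ _ T M1 M2) :
  (forall w, (N1 w <= q)%N) ->
  bc_error1 (leb_channel (q := q) N1 N2) c = product_mean (fun=> law N1) (fun n =>
    (M1 * M2)%:R^-1 *
    #|[pred m | bc_dec1 c (observe_block n (bc_enc c m.1 m.2)) != m.1]|%:R).
Proof.
move=> hN1; rewrite product_meanZ; congr (_ * _).
rewrite pair_big /=.
transitivity (\sum_(m : 'I_M1 * 'I_M2) product_mean (fun=> law N1) (fun n =>
    (bc_dec1 c (observe_block n (bc_enc c m.1 m.2)) != m.1)%:R)).
  apply: eq_bigr => m _.
  rewrite -(@sum_memoryless_fst _ N2 _ _ (fun y => (bc_dec1 c y != m.1)%:R)) //.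
  rewrite big_mkcond; apply: eq_bigr => y _.
  by case: ifP; rewrite ?mulr1 ?mulr0.
rewrite /product_mean exchange_big /=; apply: eq_big => // n _.
rewrite -mulr_sumr -sum1_card natr_sum; congr (_ * _); rewrite [RHS]big_mkcond /=.
by apply: eq_bigr => m _; rewrite inE; case: ifP.
Qed.

Definition swap_code (X Y1 Y2 : finType) (T M1 M2 : nat)
    (c : bc_code X Y1 Y2 T M1 M2) : bc_code X Y2 Y1 T M2 M1 :=
  BCCode (fun m2 m1 => bc_enc c m1 m2) (bc_dec2 c) (bc_dec1 c).

Lemma leb_channel_swap N1 N2 x y :
  leb_channel (q := q) N2 N1 x (y.2, y.1) = leb_channel (q := q) N1 N2 x y.
Proof.
by congr (fine (P _)); case: y => y1 y2; apply/seteqP; split => w /= [-> ->].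
Qed.

Lemma bc_error2_swap N1 N2 T M1 M2 (c : bc_code _ _ _ T M1 M2) :
  bc_error2 (leb_channel (q := q) N1 N2) c =
  bc_error1 (leb_channel (q := q) N2 N1) (swap_code c).
Proof.
rewrite /bc_error2 /bc_error1 mulnC; congr (_ * _); rewrite exchange_big /=.
apply: eq_bigr => m2 _; apply: eq_bigr => m1 _.
pose sw (A B C : finType) (y : {ffun A -> B * C}) := [ffun t => ((y t).2, (y t).1)].
rewrite (reindex_onto (@sw _ _ _) (@sw _ _ _)) /=; last first.
  by move=> y _; apply/ffunP => t; rewrite !ffunE; case: (y t).
apply: eq_big => y.
  rewrite (_ : sw _ _ _ (sw _ _ _ y) = y) ?eqxx ?andbT; last first.
    by apply/ffunP => t; rewrite !ffunE; case: (y t).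
  by congr (bc_dec2 c _ != _); apply/ffunP => t; rewrite !ffunE.
move=> _; apply: eq_bigr => t _; rewrite ffunE.
exact: (leb_channel_swap N2 N1).
Qed.

End Channel.

(** * Converse *)

Section Masked.
Variables (R : realType) (Om Pos : finType) (bit : Om -> Pos -> bool).
Implicit Types (A B : {set Pos}) (c : Pos).

(** Cells outside [A] read [false], so that views through different sets share one type; the fibres
    are those of the restriction to [A]. *)
Definition masked A (w : Om) : {ffun Pos -> bool} := [ffun c => (c \in A) && bit w c].

Lemma masked_eqP A w w' :
  reflect {in A, forall c, bit w' c = bit w c} (masked A w' == masked A w).
Proof.
apply: (iffP eqP) => [/ffunP e c cA|e].
  by have := e c; rewrite !ffunE cA.
by apply/ffunP => c; rewrite !ffunE; case: (boolP (c \in A)) => // /e ->.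
Qed.

Lemma masked_setU1 c A w w' : (masked (c |: A) w' == masked (c |: A) w) =
  (masked A w' == masked A w) && (bit w' c == bit w c).
Proof.
apply/masked_eqP/andP => [e|[/masked_eqP e /eqP ec] c'].
  split; last by rewrite e // setU11.
  by apply/masked_eqP => c' c'A; rewrite e // setU1r.
by rewrite in_setU1 => /predU1P[->|/e].
Qed.

Lemma masked_subset A B w w' : A \subset B -> masked B w = masked B w' ->
  masked A w = masked A w'.
Proof.
move=> /fintype.subsetP AB /eqP/masked_eqP e; apply/eqP/masked_eqP => c /AB.
exact: e.
Qed.

Section Entropy.
Variables (U : eqType) (f : Om -> U).

Definition masked_entropy A : R := entropy R (pairf f (masked A)).

Lemma masked_entropy_setU1 c A :
  masked_entropy (c |: A) = entropy R (pairf (pairf f (masked A)) (bit^~ c)).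
Proof.
by apply: eq_entropy => w w'; rewrite !xpair_eqE masked_setU1 andbA.
Qed.

Lemma masked_entropy_le_setU1 c A : masked_entropy A <= masked_entropy (c |: A).
Proof. by rewrite masked_entropy_setU1 entropy_pair_ge. Qed.

Lemma masked_entropy_setU1_le c A :
  masked_entropy (c |: A) <= masked_entropy A + ln 2.
Proof. by rewrite masked_entropy_setU1 entropy_bit_le. Qed.

Lemma masked_entropy_submodular c A B : A \subset B ->
  masked_entropy (c |: B) + masked_entropy A <=
  masked_entropy B + masked_entropy (c |: A).
Proof.
move=> AB; rewrite !masked_entropy_setU1; apply: entropy_submodular => w w'.
by rewrite /pairf => -[-> /(masked_subset AB) ->].
Qed.

End Entropy.

(** The cells are revealed one at a time, each adding at most [ln 2], starting from the empty view,
    which is constant. *)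
Lemma entropy_masked_le A : entropy R (masked A) <= #|A|%:R * ln 2.
Proof.
have -> : entropy R (masked A) = masked_entropy (fun=> tt) A.
  by apply: eq_entropy => w w'; rewrite xpair_eqE eqxx.
suff H (s : seq Pos) : masked_entropy (fun=> tt) [set c in s] <= (size s)%:R * ln 2.
  by have := H (enum A); rewrite set_enum -cardE.
elim: s => [|c s IH].
  rewrite mul0r /masked_entropy /entropy big1 ?mulr0 // => w _.
  rewrite (_ : fibre_size R _ w = #|Om|%:R).
    have [card0|card0] := eqVneq (#|Om|%:R : R) 0; last by rewrite divff // ln1.
    by rewrite card0 mul0r ln0.
  congr _%:R; apply: eq_card => w'; rewrite !inE xpair_eqE eqxx /=.
  by apply/masked_eqP => c; rewrite finset.in_set.
rewrite finset.set_cons /= -natr1 mulrDl mul1r.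
exact: le_trans (masked_entropy_setU1_le _ _ _) (lerD IH (lexx _)).
Qed.

End Masked.

(** * From Fano's inequality to the support inequalities *)

Section Converse.
Variables (R : realType) (d : measure_display) (Omega : measurableType d)
  (P : probability Omega R) (q : nat).
Implicit Types N : {RV P >-> nat}.
Local Notation word := {ffun 'I_q -> bool}.
Local Notation obs := ('I_q.+1 * {ffun 'I_q -> option bool})%type.

Section Code.
Variables (T M1 M2 : nat) (c : bc_code word obs obs T M1 M2).
Hypotheses (M1_gt0 : (0 < M1)%N) (M2_gt0 : (0 < M2)%N).

Let bit (m : 'I_M1 * 'I_M2) (p : 'I_T * 'I_q) := bc_enc c m.1 m.2 p.1 p.2.

Lemma observe_masked n m m' :
  masked bit (cells n) m = masked bit (cells n) m' ->
  observe_block n (bc_enc c m.1 m.2) = observe_block n (bc_enc c m'.1 m'.2).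
Proof.
move=> /eqP/masked_eqP e; apply/ffunP => t; rewrite !ffunE; congr pair.
apply/ffunP => j; rewrite !ffunE; case: ifP => // jn.
by congr Some; apply: (e (t, j)); rewrite inE.
Qed.

Let h := masked_entropy R bit (fun m : 'I_M1 * 'I_M2 => m.1).

Let card_msg : #|{: 'I_M1 * 'I_M2}| = (M1 * M2)%N.
Proof. by rewrite card_prod !card_ord. Qed.

Lemma first_message_entropy : ln M1%:R <= h finset.set0.
Proof.
rewrite -[M1%:R](@mulfK _ M2%:R) ?pnatr_eq0 -?lt0n // -natrM -card_msg.
apply: entropy_ge => [m|]; last by rewrite card_msg muln_gt0 M1_gt0.
apply: (@leq_trans #|finset.setX [set m.1] [set: 'I_M2]|).
  apply: subset_leq_card; apply/fintype.subsetP => m'.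
  by rewrite !inE xpair_eqE => /andP[-> _].
by rewrite cardsX cards1 cardsT card_ord mul1n.
Qed.

(** The view of receiver 1 has entropy at most [ln 2] per visible cell, and by Fano's inequality
    message 1 adds little to it. *)
Lemma fano1 n : h (cells n) <= ln 2 * #|cells n|%:R + 1 +
  ln M1%:R * ((M1 * M2)%:R^-1 *
  #|[pred m | bc_dec1 c (observe_block n (bc_enc c m.1 m.2)) != m.1]|%:R).
Proof.
rewrite [ln 2 * _]mulrC [ln M1%:R * _]mulrC.
have -> : h (cells n) = entropy R (pairf (masked bit (cells n)) fst).
  by apply: eq_entropy => m m'; rewrite !xpair_eqE andbC.
apply: (le_trans (@fano R _ _ _ (masked bit (cells n)) fst
  (fun m => bc_dec1 c (observe_block n (bc_enc c m.1 m.2))) _)).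
  by move=> m m' /observe_masked ->.
by rewrite card_msg card_ord !lerD2r entropy_masked_le.
Qed.

(** The message pair has entropy [ln M1 + ln M2]. Message 1 together with the view of receiver 2
    falls short of this by at most the Fano term for message 2, since the decoder needs only the
    view. *)
Lemma fano2 n : ln M1%:R + ln M2%:R <= h (cells n) + 1 +
  ln M2%:R * ((M1 * M2)%:R^-1 *
  #|[pred m | bc_dec2 c (observe_block n (bc_enc c m.1 m.2)) != m.2]|%:R).
Proof.
rewrite [ln M2%:R * _]mulrC.
rewrite -lnM ?posrE ?ltr0n // -natrM.
have fan := @fano R _ _ _ (pairf fst (masked bit (cells n))) snd
  (fun m => bc_dec2 c (observe_block n (bc_enc c m.1 m.2))).
rewrite card_msg card_ord in fan.
apply: le_trans (fan _) => [|m m' [_ /observe_masked -> //]].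
rewrite -[(M1 * M2)%:R]divr1 -card_msg.
apply: (@entropy_ge _ _ _ _ 1) => [m|]; last by rewrite card_msg muln_gt0 M1_gt0.
rewrite -(card1 m); apply: subset_leq_card; apply/fintype.subsetP => -[m1 m2].
by case: m => m1' m2'; rewrite !inE !xpair_eqE /= => /andP[/andP[-> _] ->].
Qed.

Lemma bc_error2E N1 N2 : (forall w, (N2 w <= q)%N) ->
  bc_error2 (leb_channel (q := q) N1 N2) c = product_mean (fun=> law N2) (fun n =>
    (M1 * M2)%:R^-1 *
    #|[pred m | bc_dec2 c (observe_block n (bc_enc c m.1 m.2)) != m.2]|%:R).
Proof.
move=> hN2; rewrite bc_error2_swap bc_error1E // mulnC.
apply: eq_bigr => n _; congr (_ * (_ * _%:R)); rewrite -!sum1_card.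
rewrite (reindex (fun m : 'I_M1 * 'I_M2 => (m.2, m.1))) /=; last first.
  by exists (fun m => (m.2, m.1)) => -[].
by apply: eq_bigl => m; rewrite !inE.
Qed.

(** The Fano bounds are averaged over the states and joined by [hybrid_inequality]. The constant 2
    covers one nat lost at receiver 1 and [w <= 1] nats at receiver 2. *)
Lemma code_converse N1 N2 (w : R) :
  (forall v, (N1 v <= q)%N) -> (forall v, (N2 v <= q)%N) -> 0 <= w <= 1 ->
  (1 - bc_error1 (leb_channel (q := q) N1 N2) c) * ln M1%:R +
  w * ((1 - bc_error2 (leb_channel (q := q) N1 N2) c) * ln M2%:R) <=
  2 + T%:R * (ln 2 *
    \sum_(j < q) Num.max (tail_prob N1 j.+1) (w * tail_prob N2 j.+1)).
Proof.
move=> hN1 hN2 w01; have [p1P p2P] := (law_dist hN1, law_dist hN2).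
rewrite bc_error1E // bc_error2E //; set e1 := product_mean _ _; set e2 := product_mean _ _.
have mean_cells : product_mean (fun=> law N1) (fun n : {ffun 'I_T -> 'I_q.+1} =>
    #|cells n|%:R) = T%:R * \sum_(j < q) tail_prob N1 j.+1.
  rewrite (_ : product_mean _ _ =
      product_mean (fun=> law N1) (fun n => #|[set: 'I_T * 'I_q] :&: cells n|%:R)).
    rewrite mean_card_cells // (eq_bigl xpredT) => [|p]; last by rewrite inE.
    rewrite -(pair_big xpredT xpredT (fun _ (j : 'I_q) => tail (law N1) j.+1)) /=.
    rewrite sumr_const card_ord mulr_natl.
    by congr (_ *+ _); apply: eq_bigr => j _; rewrite tail_law.
  by apply: eq_bigr => n _; rewrite finset.setTI.
have H3 : (1 - w) * h finset.set0 + w * product_mean (fun=> law N2) (fun n => h (cells n)) <=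
    product_mean (fun=> law N1) (fun n => h (cells n)) +
    T%:R * (ln 2 * \sum_(j < q)
      Num.max 0 (w * tail_prob N2 j.+1 - tail_prob N1 j.+1)).
  under eq_bigr do rewrite -(tail_law _ hN1) -(tail_law _ hN2).
  apply: hybrid_inequality => //.
  - exact: masked_entropy_le_setU1.
  - exact: masked_entropy_setU1_le.
  - exact: masked_entropy_submodular.
have H4 := first_message_entropy; have H1 := fano1; have H2 := fano2.
clearbody h.
move/(@ler_product_mean R T q (fun=> law N1) _ _ (fun=> p1P)): H1.
rewrite !product_meanD !product_meanZ product_mean_cst // mean_cells => H1.
move/(@ler_product_mean R T q (fun=> law N2) _ _ (fun=> p2P)): H2.
rewrite !product_meanD !product_meanZ !product_mean_cst // => H2.
have H5 : \sum_(j < q) Num.max (tail_prob N1 j.+1) (w * tail_prob N2 j.+1) =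
    \sum_(j < q) tail_prob N1 j.+1 +
    \sum_(j < q) Num.max 0 (w * tail_prob N2 j.+1 - tail_prob N1 j.+1).
  transitivity (\sum_(j < q) (tail_prob N1 j.+1 +
      Num.max 0 (w * tail_prob N2 j.+1 - tail_prob N1 j.+1))); last first.
    by rewrite big_split.
  apply: eq_bigr => j _; by rewrite addr_maxr addr0; congr Num.max; ring.
rewrite H5 /e1 /e2 !product_meanZ.
have lnM2 : 0 <= ln M2%:R :> R by rewrite ln_ge0 // ler1n.
case/andP: w01 => w0 w1.
have := ler_wpM2l w0 H2; have : (1 - w) * ln M1%:R <= (1 - w) * h finset.set0.
  by rewrite ler_wpM2l ?subr_ge0.
move: H1 H2 H3 H4 w1; lra.
Qed.

End Code.

Lemma num_messages_gt0 T (r : R) : (0 < num_messages T r)%N.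
Proof. by rewrite /num_messages expn_gt0. Qed.

Lemma ln_num_messages T (r : R) : 0 <= r ->
  T%:R * (r * ln 2) <= ln (num_messages T r)%:R.
Proof.
move=> r0; rewrite natrX lnXn // -[leRHS]mulr_natl mulrA ler_wpM2r ?ln_ge0 ?ler1n //.
have Tr0 : 0 <= T%:R * r by rewrite mulr_ge0.
by rewrite natr_absz ger0_norm ?ceil_ge // ceil_ge0 (lt_le_trans _ Tr0) // ltrN10.
Qed.

Lemma achievable_support N1 N2 (w : R) (r : R^o * R^o) :
  (forall v, (N1 v <= q)%N) -> (forall v, (N2 v <= q)%N) -> 0 <= w <= 1 ->
  bc_achievable (leb_channel (q := q) N1 N2) r ->
  r.1 + w * r.2 <=
    \sum_(j < q) Num.max (tail_prob N1 j.+1) (w * tail_prob N2 j.+1).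
Proof.
move=> hN1 hN2 w01 [r10 r20 [c [e1 e2]]].
set V := \sum_(j < q) _.
have ln2 : 0 < ln 2 :> R by rewrite ln_gt0 // ltr1n.
set W := leb_channel (q := q) N1 N2 in e1 e2.
have L : (fun T => (1 - bc_error1 W (c T)) * r.1 +
    w * ((1 - bc_error2 W (c T)) * r.2)) @ \oo --> r.1 + w * r.2.
  rewrite -[X in _ --> X](_ : (1 - 0) * r.1 + w * ((1 - 0) * r.2) = _).
    apply: cvgD; first by apply: cvgMl; apply: cvgB => //; exact: cvg_cst.
    by apply: cvgMr; apply: cvgMl; apply: cvgB => //; exact: cvg_cst.
  by rewrite subr0 !mul1r.
(* After division by [T ln 2] the overhead is [2 / (T ln 2)], at most [4 / ((T + 1) ln 2)] for
   [T >= 1]; [harmonic T] is [1 / (T + 1)]. *)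
have RL : (fun T => 4 / ln 2 * harmonic T + V) @ \oo --> V.
  rewrite -[X in _ --> X](_ : 4 / ln 2 * 0 + V = _); last by rewrite mulr0 add0r.
  by apply: cvgD; [apply: cvgMr; exact: cvg_harmonic|exact: cvg_cst].
apply: (ler_cvg_to L RL).
(* Eventually both errors are at most 1, so the factors [1 - error] may multiply the lower bounds on
   the logarithms of the message counts. *)
have near1 (f : nat -> R) : f T @[T --> \oo] --> 0 -> \forall T \near \oo, f T <= 1.
  by move=> f0; apply: (cvgr_le 0).
near=> T.
have T0 : 0 < T%:R :> R by rewrite ltr0n; near: T; exact: nbhs_infty_gt.
have e1T : bc_error1 W (c T) <= 1 by near: T; exact: near1.
have e2T : bc_error2 W (c T) <= 1 by near: T; exact: near1.
have := code_converse (c T) (num_messages_gt0 _ _) (num_messages_gt0 _ _) hN1 hN2 w01.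
rewrite -/W -/V.
have := ler_wpM2l (_ : 0 <= 1 - bc_error1 W (c T)) (ln_num_messages T r10).
have := ler_wpM2l (_ : 0 <= 1 - bc_error2 W (c T)) (ln_num_messages T r20).
move: (bc_error1 W (c T)) (bc_error2 W (c T)) e1T e2T => x1 x2 x11 x21.
rewrite !subr_ge0 => /(_ x21) A2 /(_ x11) A1.
have w0 : 0 <= w by case/andP: w01.
move: (ler_wpM2l w0 A2) => {}A2 H.
have {A1 A2}H : T%:R * ln 2 * ((1 - x1) * r.1 + w * ((1 - x2) * r.2)) <=
    T%:R * ln 2 * (2 / (T%:R * ln 2) + V).
  rewrite [leRHS]mulrDr [X in _ <= X + _]mulrCA divff ?mulr1; last by rewrite mulf_neq0 ?gt_eqF.
  lra.
rewrite ler_pM2l ?mulr_gt0 // in H; apply: (le_trans H); rewrite lerD2r.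
have T1 : 1 <= T%:R :> R by rewrite ler1n -(ltr0n R).
rewrite ler_pdivrMr ?mulr_gt0 // /harmonic /=.
rewrite (_ : T.+1%:R = T%:R + 1 :> R); last by rewrite natr1.
have -> : 4 / ln 2 * (T%:R + 1)^-1 * (T%:R * ln 2) = 4 * T%:R / (T%:R + 1) :> R.
  by field; rewrite !gt_eqF //; lra.
by rewrite ler_pdivlMr; lra.
Unshelve. all: by end_near.
Qed.

End Converse.

(** * Pairs satisfying all support inequalities *)

Lemma seq_argmin (R : realDomainType) (T : eqType) (f : T -> R) (Q : pred T)
    (l : seq T) : has Q l ->
  exists x, [/\ x \in l, Q x & {in l, forall y, Q y -> f x <= f y}].
Proof.
elim: l => //= y l IH; have [hl _|hl] := boolP (has Q l).
  have [x [xl Qx xmin]] := IH hl; have [Qy|nQy] := boolP (Q y); last first.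
    exists x; split=> //; first by rewrite inE xl orbT.
    by move=> z; rewrite inE => /predU1P[->|/xmin//]; rewrite (negbTE nQy).
  have [fxy|fyx] := leP (f x) (f y).
    exists x; split=> //; first by rewrite inE xl orbT.
    by move=> z; rewrite inE => /predU1P[-> //|/xmin].
  exists y; split=> //; first by rewrite inE eqxx.
  by move=> z; rewrite inE => /predU1P[-> //|/xmin h /h]; apply: le_trans; apply: ltW.
rewrite orbF => Qy; exists y; split=> //; first by rewrite inE eqxx.
move=> z; rewrite inE => /predU1P[-> //|zl Qz].
by move: hl; rewrite -all_predC => /allP/(_ z zl); rewrite /= Qz.
Qed.

Section SupportedRates.
Variables (R : realType) (s : seq nat) (F1 F2 : nat -> R).
Hypotheses (F1_ge0 : forall n, 0 <= F1 n) (F2_ge0 : forall n, 0 <= F2 n).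

Definition corner1 (w : R) := \sum_(n <- s | 0 < F1 n - w * F2 n) F1 n.
Definition corner2 (w : R) := \sum_(n <- s | F1 n - w * F2 n <= 0) F2 n.
Definition support_function (w : R) := \sum_(n <- s) Num.max (F1 n) (w * F2 n).

(** The maximum is attained layer by layer, so the corner of [w'] lies on the supporting line of
    weight [w] once its choice of layers is optimal for [w] too; ties may go either way. *)
Lemma corner_support (w w' : R) :
  {in s, forall n, if F1 n - w' * F2 n <= 0 then F1 n <= w * F2 n
                   else w * F2 n <= F1 n} ->
  corner1 w' + w * corner2 w' = support_function w.
Proof.
move=> h; rewrite /support_function (bigID (fun n => 0 < F1 n - w' * F2 n)) /= /corner2 mulr_sumr.
congr (_ + _).
  rewrite /corner1 big_seq_cond [RHS]big_seq_cond; apply: eq_bigr => n /andP[ns n0].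
  by have := h n ns; rewrite leNgt n0 /= => /max_l.
rewrite big_seq_cond [RHS]big_seq_cond; apply: eq_big => n; first by rewrite leNgt.
by move=> /andP[ns n0]; have := h n ns; rewrite n0 => /max_r.
Qed.

(* [w] is the least critical ratio [F1 n / F2 n] at which [corner2] reaches [r2]
   and [w'] the largest one below [w]: the corners of [w'] and [w] are the
   endpoints of an edge of slope [- 1 / w], which lies above [(r1, r2)]. *)
Lemma supported_rates_between_corners (r1 r2 : R) : 0 <= r1 -> 0 <= r2 ->
  (forall w, 0 <= w -> r1 + w * r2 <= support_function w) -> r2 <= \sum_(n <- s) F2 n ->
  exists w w' l a1 a2 b1 b2 : R,
  [/\ 0 <= w /\ 0 <= w', 0 <= l <= 1,
      0 <= a1 <= corner1 w /\ 0 <= a2 <= corner2 w,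
      0 <= b1 <= corner1 w' /\ 0 <= b2 <= corner2 w' &
      r1 = l * a1 + (1 - l) * b1 /\ r2 = l * a2 + (1 - l) * b2].
Proof.
move=> r10 r20 hsup hr2.
(* The layers counted by [corner2 0] cost receiver 1 nothing; if they suffice for [r2], a single
   rectangle contains the pair. *)
have [le0|gt0] := leP r2 (corner2 0).
  exists 0, 0, 1, r1, r2, r1, r2; rewrite r10 r20 le0 /=.
  suff : r1 <= corner1 0.
    by move=> ->; rewrite !lexx ler01 subrr !mul1r !mul0r !addr0; do !split.
  have := hsup 0 (lexx 0); rewrite mul0r addr0 -(@corner_support 0 0).
    by rewrite mul0r addr0.
  by move=> n _; rewrite !mul0r subr0; case: ifP.
(* The corners change only at the ratios [F1 n / F2 n]; 0 is added so that there is always a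
   candidate below [w > 0]. *)
pose cand := 0 :: [seq F1 n / F2 n | n <- s & 0 < F2 n].
have cand_ge0 w : w \in cand -> 0 <= w.
  by rewrite inE => /predU1P[->//|/mapP[n _ ->]]; rewrite divr_ge0.
have cand_ratio n : n \in s -> 0 < F2 n -> F1 n / F2 n \in cand.
  move=> ns n0; rewrite inE; apply/orP; right; apply/mapP.
  by exists n; rewrite // mem_filter n0.
have has_cand : has (fun w => r2 <= corner2 w) cand.
  (* Minimising [-%R] picks the largest candidate, at which every layer with [F2 n > 0] is given to
     receiver 2. *)
  have [|w [wc _ wmax]] := @seq_argmin R R -%R xpredT cand => //.
  apply/hasP; exists w => //; apply: (le_trans hr2).
  rewrite /corner2 [leRHS]big_mkcond big_seq [leRHS]big_seq; apply: ler_sum => n ns.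
  case: ifP => // /negbT; rewrite -ltNge => nw.
  have [n0|//] := ltP 0 (F2 n); have := wmax _ (cand_ratio n ns n0) isT.
  rewrite lerN2 ler_pdivrMr // => ?; lra.
have [w [wc r2w wmin]] := @seq_argmin R R id _ _ has_cand.
have w0 : 0 < w.
  rewrite lt_neqAle cand_ge0 // andbT; apply/eqP => w0.
  by move: r2w; rewrite -w0 leNgt gt0.
have has_below : has (fun x => x < w) cand by rewrite /= w0.
have [w' [wc' w'w w'max]] := @seq_argmin R R -%R _ _ has_below.
have r2w' : corner2 w' < r2.
  by rewrite ltNge; apply/negP => /(wmin _ wc'); rewrite leNgt w'w.
have S : corner1 w + w * corner2 w = support_function w.
  by apply: corner_support => n _; case: ifP => [|/negbT]; rewrite -?ltNge => ?; lra.
(* No critical ratio lies strictly between [w'] and [w], so the layers chosen at [w'] are also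
   optimal for the weight [w]. *)
have S' : corner1 w' + w * corner2 w' = support_function w.
  apply: corner_support => n ns; have F20 := F2_ge0 n.
  case: ifP => [|/negbT]; rewrite -?ltNge => h.
    have : w' * F2 n <= w * F2 n by rewrite ler_wpM2r // ltW.
    lra.
  have [n0|n0] := ltP 0 (F2 n); last first.
    have -> : F2 n = 0 by apply/le_anti; rewrite n0 F20.
    by rewrite mulr0.
  rewrite -ler_pdivlMr // leNgt; apply/negP => nw.
  have := w'max _ (cand_ratio n ns n0) nw; rewrite lerN2 ler_pdivrMr //.
  lra.
have c1_ge0 x : 0 <= corner1 x by apply: sumr_ge0.
have c2_ge0 x : 0 <= corner2 x by apply: sumr_ge0.
pose l := (corner2 w - r2) / (corner2 w - corner2 w').
have dc : 0 < corner2 w - corner2 w' by lra.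
have l01 : 0 <= l <= 1 by rewrite divr_ge0 ?ler_pdivrMr //=; lra.
have lE : r2 = l * corner2 w' + (1 - l) * corner2 w.
  have : l * (corner2 w - corner2 w') = corner2 w - r2 by rewrite mulfVK // gt_eqF.
  lra.
pose m := l * corner1 w' + (1 - l) * corner1 w.
have m0 : 0 <= m by rewrite addr_ge0 // mulr_ge0 //; lra.
have r1m : r1 <= m.
  have := hsup w (ltW w0); have : m + w * r2 = support_function w; last by lra.
  rewrite lE -[RHS](_ : l * support_function w + (1 - l) * support_function w = _); last by ring.
  by rewrite -{1}S' -S /m; ring.
(* The edge has first coordinate [m >= r1] at height [r2]; scaling first coordinates by [th] reaches
   [r1]. If [m = 0] the quotient is 0 by convention, which fits because then [r1 = 0]. *)
pose th := r1 / m.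
have th01 : 0 <= th <= 1.
  rewrite /th divr_ge0 //=; have [->|m1] := eqVneq m 0; first by rewrite invr0 mulr0.
  by rewrite ler_pdivrMr ?mul1r // lt_neqAle eq_sym m1.
exists w', w, l, (th * corner1 w'), (corner2 w'), (th * corner1 w), (corner2 w).
have thle x : 0 <= th * corner1 x <= corner1 x.
  by case/andP: th01 => ? ?; rewrite mulr_ge0 //= ler_piMl.
split=> //.
- by rewrite (ltW w0) cand_ge0.
- by rewrite thle c2_ge0 lexx.
- by rewrite thle c2_ge0 lexx.
split=> //; rewrite !(mulrCA _ th) -mulrDr -/m /th.
have [m1|m1] := eqVneq m 0; last by rewrite mulfVK.
by rewrite m1 mulr0; apply/le_anti; rewrite r10 -m1 r1m.
Qed.
End SupportedRates.

(** * Codebooks *)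

Section Chebyshev.
Variables (R : realType) (T q : nat) (p : 'I_q.+1 -> R) (A : {set 'I_T * 'I_q}).
Hypothesis pP : prob_dist p.

Let Z (t : 'I_T) (k : 'I_q.+1) : R := \sum_(j < q | (t, j) \in A) (j < k)%N%:R.
Let mu t := \sum_k p k * Z t k.
Let Y t k := Z t k - mu t.

Let Z_itv t k : 0 <= Z t k <= q%:R.
Proof.
rewrite sumr_ge0 //= (_ : q%:R = \sum_(j < q) 1); last by rewrite sumr_const card_ord.
rewrite /Z big_mkcond; by apply: ler_sum => j _; case: ifP => // _; case: (_ < _)%N; rewrite ?ler01.
Qed.

Let Y_mean t : \sum_k p k * Y t k = 0.
Proof.
under eq_bigr do rewrite mulrBr.
by rewrite sumrB -mulr_suml; case: pP => _ ->; rewrite mul1r subrr.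
Qed.

Let Y_le t k : Y t k ^+ 2 <= q%:R ^+ 2.
Proof.
have [p0 p1] := pP; have /andP[Z0 Zq] := Z_itv t k.
have mu0 : 0 <= mu t.
  by apply: sumr_ge0 => i _; have /andP[Zi _] := Z_itv t i; exact: mulr_ge0.
have muq : mu t <= q%:R.
  rewrite (_ : q%:R = \sum_i p i * q%:R); last by rewrite -mulr_suml p1 mul1r.
  apply: ler_sum => i _.
  by have /andP[_ Zq2] := Z_itv t i; exact: ler_wpM2l.
by rewrite -real_normK ?num_real // lerXn2r ?nnegrE // ler_norml /Y; lra.
Qed.

(** Chebyshev's inequality: the count is a sum over independent slots, and a slot of [q] cells
    contributes at most [q ^ 2] to the variance. *)
Lemma card_cells_deviation (x : R) : 0 < x ->
  product_mean (fun=> p) (fun n =>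
    (#|A :&: cells n|%:R <= \sum_(c in A) tail p c.2.+1 - x)%R%:R) <=
  T%:R * q%:R ^+ 2 / x ^+ 2.
Proof.
move=> x0.
have SE (n : {ffun 'I_T -> 'I_q.+1}) : #|A :&: cells n|%:R = \sum_t Z t (n t).
  rewrite pair_big_dep -sum1_card natr_sum [LHS]big_mkcond [RHS]big_mkcond /=.
  apply: eq_bigr => -[t j] _; rewrite !inE /=; case: (_ \in A) => //=.
  by case: (_ < _)%N.
have mE : \sum_(c in A) tail p c.2.+1 = \sum_t mu t.
  rewrite -mean_card_cells // (_ : product_mean _ _ =
     product_mean (fun=> p) (fun n => \sum_t Z t (n t))).
    by rewrite product_mean_sum; apply: eq_bigr => t _; rewrite product_mean_marginal.
  by apply: eq_bigr => n _; rewrite SE.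
have var : product_mean (fun=> p) (fun n => (\sum_t Y t (n t)) ^+ 2) <=
    T%:R * q%:R ^+ 2.
  rewrite (_ : product_mean _ _ = product_mean (fun=> p) (fun n =>
      \sum_t \sum_s Y t (n t) * Y s (n s))); last first.
    by apply: eq_bigr => n _; rewrite expr2 big_distrlr.
  rewrite product_mean_sum mulr_natl -[T in leRHS]card_ord -sumr_const.
  apply: ler_sum => t _; rewrite product_mean_sum (bigD1 t) //= big1 ?addr0 => [|s st].
    rewrite -[leRHS](@product_mean_cst R T q (fun=> p)) //.
    by apply: ler_product_mean => // n; rewrite -expr2 Y_le.
  (* For [s != t] the mean of the product factors over the coordinates, and the centred factor at
     [t] has mean 0. *)
  pose g u k := if u == t then Y t k else if u == s then Y s k else 1.
  rewrite (_ : product_mean _ _ =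
      product_mean (fun=> p) (fun n => \prod_u g u (n u))).
    rewrite product_mean_prod (bigD1 t) //= [X in X * _](_ : _ = 0) ?mul0r //.
    by rewrite /g eqxx Y_mean.
  apply: eq_bigr => n _; congr (_ * _).
  rewrite (bigD1 t) //= (bigD1 s) //= big1 ?mulr1 => [|u /andP[/negbTE ut /negbTE us]].
    by rewrite /g eqxx (negbTE st) eqxx.
  by rewrite /g ut us.
rewrite ler_pdivlMr ?exprn_gt0 // mulrC.
apply: (le_trans _ var); rewrite -product_meanZ; apply: ler_product_mean => // n.
rewrite SE mE sumrB; case: (boolP (\sum_t Z t (n t) <= _)) => dev; last first.
  by rewrite /= mulr0n mulr0 sqr_ge0.
by rewrite /= mulr1n mulr1 -[leRHS]sqrrN lerXn2r ?nnegrE; lra.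
Qed.

End Chebyshev.

(** * Greedy choice of codewords *)

Section RandomCodebook.
Variables (R : realType) (Pos : finType).
Implicit Types (D : {set Pos}).

Definition agree D (x x' : {ffun Pos -> bool}) := [forall c in D, x c == x' c].

Lemma agreeC D x x' : agree D x x' = agree D x' x.
Proof. by apply: eq_forallb => c; rewrite eq_sym. Qed.

(** The indicator of agreement is a product over the cells, so the sum over all words factors: a
    cell of [D] contributes 1, any other cell 2. *)
Lemma sum_agree D x' :
  \sum_(x : {ffun Pos -> bool}) (agree D x x')%:R = #|{ffun Pos -> bool}|%:R * 2^-1 ^+ #|D| :> R.
Proof.
pose F c b : R := if c \in D then (b == x' c)%:R else 1.
transitivity (\sum_(x : {ffun Pos -> bool}) \prod_c F c (x c)).
  apply: eq_bigr => x _; rewrite /agree; case: (boolP [forall c in D, _]).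
    move=> /forall_inP e; rewrite big1 // => c _; rewrite /F.
    by case: ifP => // /e ->.
  rewrite negb_forall => /existsP[c]; rewrite negb_imply => /andP[cD /negbTE ne].
  by rewrite (bigD1 c) //= /F cD ne mul0r.
rewrite -bigA_distr_bigA card_ffun card_bool natrX -prodr_const -prodr_const.
rewrite [X in _ = _ * X]big_mkcond -big_split; apply: eq_bigr => c _.
rewrite big_bool /F /=; case: (c \in D); last by rewrite mulr1.
by rewrite mulfV //; case: (x' c); rewrite /= ?addr0 ?add0r.
Qed.

(* Codewords are picked one after the other, each no worse than an average word
   against those already chosen. *)
Lemma greedy_codebook (X : finType) (cost : X -> X -> R) (kappa : R) :
  (0 < #|X|)%N -> 0 <= kappa ->
  (forall y, \sum_x cost x y <= #|X|%:R * kappa) ->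
  forall M : nat, exists C : nat -> X,
    \sum_(i < M) \sum_(j < i) cost (C i) (C j) <= M%:R ^+ 2 * kappa.
Proof.
move=> X0 kappa0 hc.
elim=> [|M [C IH]].
  by case/card_gt0P: X0 => x _; exists (fun=> x); rewrite big_ord0 expr0n mul0r.
have [x hx] : exists x : X, \sum_(j < M) cost x (C j) <= M%:R * kappa.
  apply/not_existsP => H.
  have : \sum_(x : X) \sum_(j < M) cost x (C j) <= #|X|%:R * (M%:R * kappa).
    rewrite exchange_big /= mulrCA mulr_natl -[M in leRHS]card_ord -sumr_const.
    by apply: ler_sum => j _; exact: hc.
  rewrite leNgt => /negP; apply; rewrite mulr_natl -sumr_const.
  case/card_gt0P: X0 => x _; apply: ltr_sum; last by move=> y _; rewrite ltNge; apply/negP/H.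
  by apply/hasP; exists x; rewrite ?mem_index_enum.
exists (fun i => if i == M then x else C i).
have fE (i : nat) : (i < M)%N -> (if i == M then x else C i) = C i.
  by move=> iM; rewrite ltn_eqF.
rewrite big_ord_recr /= eqxx; apply: (@le_trans _ _ (M%:R ^+ 2 * kappa + M%:R * kappa)).
  apply: lerD.
    apply: le_trans IH; apply: ler_sum => i _; apply: ler_sum => j _.
    by rewrite !fE // (ltn_trans (ltn_ord j)).
  by apply: le_trans hx; apply: ler_sum => j _; rewrite fE.
rewrite -mulrDl ler_wpM2r // -natr1.
have : 0 <= M%:R :> R by [].
by move: (M%:R) => m m0; rewrite sqrrD; lra.
Qed.

End RandomCodebook.

(** * Codewords seen through random erasures *)

Section Codebook.
Variables (R : realType) (T q : nat) (p : 'I_q.+1 -> R) (A : {set 'I_T * 'I_q}).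
Hypothesis pP : prob_dist p.
Local Notation word := {ffun 'I_T * 'I_q -> bool}.

(* The codeword [C i] cannot be told from all others when only the cells [A] of
   the input that survive the states [n] are seen. *)
Definition ambiguous (C : nat -> word) M n (i : 'I_M) :=
  [exists i' : 'I_M, (i' != i) && agree (A :&: cells n) (C i) (C i')].

Definition ambiguity (C : nat -> word) M : R :=
  M%:R^-1 * \sum_(i < M) product_mean (fun=> p) (fun n => (ambiguous C n i)%:R).

(** Either fewer than [K] cells of [A] survive, which is unlikely by Chebyshev's inequality, or a
    uniform word agrees with a fixed one on the survivors with probability at most [2^-1 ^+ K]. The
    factor 2 passes from the pairs [j < i] of the greedy choice to ordered pairs. *)
Lemma exists_codebook (M K : nat) (x : R) : (0 < M)%N -> 0 < x ->
  K%:R <= \sum_(c in A) tail p c.2.+1 - x ->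
  exists C, ambiguity C M <= T%:R * q%:R ^+ 2 / x ^+ 2 + M%:R * 2 * 2^-1 ^+ K.
Proof.
move=> M0 x0 hK; pose good n := (K <= #|A :&: cells n|)%N.
pose cost (u v : word) : R := product_mean (fun=> p) (fun n =>
  (good n && agree (A :&: cells n) u v)%:R).
have costC u v : cost u v = cost v u.
  by apply: eq_bigr => n _; rewrite agreeC.
have [||v|C HC] := @greedy_codebook R _ cost (2^-1 ^+ K) _ _ _ M.
- by apply/card_gt0P; exists [ffun=> false].
- by rewrite exprn_ge0.
- rewrite -product_mean_sum -[leRHS](@product_mean_cst R T q (fun=> p)) //.
  apply: ler_product_mean => // n; case: (boolP (good n)) => [gn|_] /=; last first.
    by rewrite big1 // mulr_ge0 ?exprn_ge0.
  rewrite sum_agree ler_wpM2l //; apply: ler_wiXn2l; rewrite ?invr_ge0 //.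
  by rewrite invf_le1 // ler1n.
exists C; rewrite /ambiguity.
have step (i : 'I_M) : product_mean (fun=> p) (fun n => (ambiguous C n i)%:R) <=
    T%:R * q%:R ^+ 2 / x ^+ 2 + \sum_(i' < M | i' != i) cost (C i) (C i').
  apply: (@le_trans _ _ (product_mean (fun=> p) (fun n =>
    (#|A :&: cells n|%:R <= \sum_(c in A) tail p c.2.+1 - x)%R%:R +
    \sum_(i' < M | i' != i) (good n && agree (A :&: cells n) (C i) (C i'))%:R))).
    apply: ler_product_mean => // n.
    have S0 : 0 <= \sum_(i' < M | i' != i)
        (good n && agree (A :&: cells n) (C i) (C i'))%:R :> R by apply: sumr_ge0.
    case: (boolP (good n)) S0 => [gn|bad] S0.
      rewrite -[leLHS]add0r lerD //.
      case: (boolP (ambiguous C n i)) => [/existsP[i' /andP[ne ag]]|_] //.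
      by rewrite (bigD1 i') //= ag lerDl; apply: sumr_ge0.
    rewrite (_ : (#|A :&: cells n|%:R <= _)%R) => [|/=].
      apply: (@le_trans _ _ 1); last by rewrite lerDl.
      by case: (ambiguous _ _ _).
    by apply: le_trans hK; rewrite ler_nat ltnW // ltnNge; exact: bad.
  rewrite product_meanD lerD ?card_cells_deviation //.
  by rewrite product_mean_sum.
have M0' : 0 < M%:R :> R by rewrite ltr0n.
rewrite ler_pdivrMl //; apply: (le_trans (ler_sum _ (fun i _ => step i))).
rewrite big_split /= sumr_const card_ord mulrDr -[X in X + _]mulr_natl lerD2l.
have -> : \sum_(i < M) \sum_(i' < M | i' != i) cost (C i) (C i') =
    2 * \sum_(i < M) \sum_(j < i) cost (C i) (C j).
  have -> : \sum_(i < M) \sum_(j < i) cost (C i) (C j) =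
      \sum_(i < M) \sum_(j < M | (j < i)%N) cost (C i) (C j).
    apply: eq_bigr => i _; rewrite (@big_ord_widen _ _ _ i M (fun j => cost (C i) (C j))) //.
    exact: ltnW.
  rewrite mulrDl !mul1r [X in _ = X + _](exchange_big_dep predT) //= -big_split.
  apply: eq_bigr => i _ /=.
  rewrite (bigID (fun i' : 'I_M => (i < i')%N)) /=; congr (_ + _); apply: eq_big.
  - by move=> j; rewrite neq_ltn; case: ltngtP.
  - by move=> j _; exact: costC.
  - by move=> j; rewrite neq_ltn; case: ltngtP.
  - by [].
rewrite expr2 in HC; lra.
Qed.

End Codebook.

(** * Achievability *)

Section LayeredCode.
Variables (R : realType) (T q : nat).
Local Notation word := {ffun 'I_T * 'I_q -> bool}.
Local Notation obs := ('I_q.+1 * {ffun 'I_q -> option bool})%type.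
Implicit Types (A : {set 'I_T * 'I_q}) (C : nat -> word).

Definition consistent A C (y : {ffun 'I_T -> obs}) (m : nat) :=
  [forall c in A, if (y c.1).2 c.2 is Some b then b == C m c else true].

Definition decode A C M (m0 : 'I_M) (y : {ffun 'I_T -> obs}) : 'I_M :=
  odflt m0 [pick m : 'I_M | consistent A C y m].

(** The true message is consistent with every observation, so the search never fails; a wrong output
    is another consistent message, whose codeword agrees with the true one on the visible cells of
    [A]. *)
Lemma decode_ambiguous A C M (m0 m : 'I_M) n (x : {ffun 'I_T -> {ffun 'I_q -> bool}}) :
  {in A, forall c, x c.1 c.2 = C m c} ->
  decode A C m0 (observe_block n x) != m -> ambiguous A C n m.
Proof.
move=> xC; rewrite /decode; case: pickP => [m' /forall_inP cons ne|/(_ m)/negbT/negP[]].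
  apply/existsP; exists m'; rewrite ne; apply/forall_inP => -[t j].
  rewrite inE => /andP[cA]; rewrite inE /= => jn.
  by have := cons _ cA; rewrite !ffunE /= jn -xC // => /eqP ->.
apply/forall_inP => -[t j] cA; rewrite !ffunE /=; case: ifP => // _.
by rewrite -xC.
Qed.

Definition layered_code A C1 C2 M1 M2 (i1 : 'I_M1) (i2 : 'I_M2) :
    bc_code {ffun 'I_q -> bool} obs obs T M1 M2 :=
  BCCode
    (fun m1 m2 => [ffun t => [ffun j =>
       if (t, j) \in A then C1 m1 (t, j) else C2 m2 (t, j)]])
    (decode A C1 i1) (decode (~: A) C2 i2).

Variables (d : measure_display) (Omega : measurableType d)
  (P : probability Omega R) (N1 N2 : {RV P >-> nat}).
Hypotheses (hN1 : forall w, (N1 w <= q)%N) (hN2 : forall w, (N2 w <= q)%N).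

(** The decoder inspects only the cells of [A], where the input is the codeword of message 1;
    message 2 therefore drops out of the average. *)
Lemma layered_code_error1 A C1 C2 M1 M2 (i1 : 'I_M1) (i2 : 'I_M2) :
  bc_error1 (leb_channel (q := q) N1 N2) (layered_code A C1 C2 i1 i2) <=
  ambiguity (law N1) A C1 M1.
Proof.
have M2_gt0 : 0 < M2%:R :> R by rewrite ltr0n (leq_trans _ (ltn_ord i2)).
rewrite bc_error1E // /ambiguity -product_mean_sum -product_meanZ.
apply: ler_product_mean => [_|n]; first exact: law_dist.
rewrite natrM invfM -mulrA ler_wpM2l ?invr_ge0 // mulrC ler_pdivrMr //.
rewrite mulr_suml -sum1_card natr_sum big_mkcond /=.
rewrite -(pair_big xpredT xpredT (fun m1 m2 => if (m1, m2) \in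
  [pred m | decode A C1 i1
    (observe_block n (bc_enc (layered_code A C1 C2 i1 i2) m.1 m.2)) != m.1]
  then 1 : R else 0)) /=.
apply: ler_sum => m1 _; rewrite mulr_natr -[M2 in leRHS]card_ord -sumr_const.
apply: ler_sum => m2 _; rewrite inE /=; case: ifP => // ne.
rewrite (decode_ambiguous _ ne) // => -[t j] cA.
by rewrite !ffunE cA.
Qed.

Lemma layered_code_error2 A C1 C2 M1 M2 (i1 : 'I_M1) (i2 : 'I_M2) :
  bc_error2 (leb_channel (q := q) N1 N2) (layered_code A C1 C2 i1 i2) <=
  ambiguity (law N2) (~: A) C2 M2.
Proof.
have M1_gt0 : 0 < M1%:R :> R by rewrite ltr0n (leq_trans _ (ltn_ord i1)).
rewrite bc_error2E // /ambiguity -product_mean_sum -product_meanZ.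
apply: ler_product_mean => [_|n]; first exact: law_dist.
rewrite mulnC natrM invfM -mulrA ler_wpM2l ?invr_ge0 // mulrC ler_pdivrMr //.
rewrite mulr_suml -sum1_card natr_sum big_mkcond /=.
rewrite -(pair_big xpredT xpredT (fun m1 m2 => if (m1, m2) \in
  [pred m | decode (~: A) C2 i2
    (observe_block n (bc_enc (layered_code A C1 C2 i1 i2) m.1 m.2)) != m.2]
  then 1 : R else 0)) /= exchange_big /=.
apply: ler_sum => m2 _; rewrite mulr_natr -[M1 in leRHS]card_ord -sumr_const.
apply: ler_sum => m1 _; rewrite inE /=; case: ifP => // ne.
rewrite (decode_ambiguous _ ne) // => -[t j] cA.
by move: cA; rewrite inE !ffunE => /negbTE ->.
Qed.

End LayeredCode.

(** * Error of a codebook at a given rate *)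

Section Achievability.
Variables (R : realType) (q : nat) (p : 'I_q.+1 -> R).
Hypothesis pP : prob_dist p.

(** Up to the factor [T], the first term is Chebyshev's bound for a deviation [T delta / 2] and the
    second bounds [2 * 2^-1 ^+ L] with [L] about [T delta / 4]. *)
Definition error_rate (delta : R) : R := 4 * q%:R ^+ 2 / delta ^+ 2 + 8 / delta.

(** Of the slack [T delta], half is the allowed deviation, a quarter pays for [L] cells beyond the
    [k] message bits, and the last quarter absorbs [q] and the rounding up in [k]. *)
Lemma ambiguity_rate T (A : {set 'I_T * 'I_q}) (r delta : R) :
  0 <= r -> 0 < delta -> q%:R + 1 <= T%:R * delta / 4 ->
  (0 < r -> T%:R * (r + delta) - q%:R <= \sum_(c in A) tail p c.2.+1) ->
  exists C, ambiguity p A C (num_messages T r) <= error_rate delta / T%:R.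
Proof.
move=> r0 d0 hT hA.
have q0 : 0 <= q%:R :> R by [].
have T0 : 0 < T%:R :> R.
  by rewrite lt0r ler0n andbT; apply/eqP => T0; move: hT; rewrite T0 !mul0r; lra.
have rate0 : 0 <= error_rate delta / T%:R.
  by rewrite divr_ge0 // addr_ge0 // !(mulr_ge0, invr_ge0, exprn_ge0) // ltW.
have [r1|] := eqVneq r 0.
  exists (fun=> [ffun=> false]); apply: le_trans rate0.
  rewrite /ambiguity big1 ?mulr0 // => i _.
  rewrite -[RHS](@product_mean_cst R T q (fun=> p)) //; apply: eq_bigr => n _.
  congr (_ * _); rewrite (_ : ambiguous _ _ _ _ = false) //.
  apply/existsP => -[i' /andP[/negP[]]]; move: i i'.
  by rewrite /num_messages r1 mulr0 ceil0 => i i'; rewrite !ord1.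
move=> rn0; have {rn0} r1 : 0 < r by rewrite lt0r rn0 r0.
have {}hA := hA r1; rewrite /num_messages; set k := `|_|%N.
have Tr0 : 0 <= T%:R * r by rewrite mulr_ge0 // ltW.
have kE : k%:R < T%:R * r + 1.
  rewrite natr_absz ger0_norm ?ceil_ge0 ?(lt_le_trans _ Tr0) ?ltrN10 //.
  by have /andP[+ _] := ceil_itv (T%:R * r); rewrite rmorphB rmorph1 ltrBlDr.
pose L := Num.truncn (T%:R * delta / 4).
have /andP[L1 L2] : L%:R <= T%:R * delta / 4 < L.+1%:R.
  by apply: truncn_itv; lra.
have x0 : 0 < T%:R * delta / 2 by rewrite divr_gt0 // mulr_gt0.
have M0 : (0 < 2 ^ k)%N by rewrite expn_gt0.
have [|C HC] := @exists_codebook R T q p A pP (2 ^ k) (k + L) _ M0 x0.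
  rewrite natrD; lra.
exists C; apply: (le_trans HC); rewrite /error_rate mulrDl; apply: lerD.
  by rewrite le_eqVlt; apply/orP; left; apply/eqP; field; rewrite !gt_eqF.
have -> : (2 ^ k)%:R * 2 * 2^-1 ^+ (k + L) = 2 * 2^-1 ^+ L :> R.
  by rewrite exprD exprVn natrX; field; rewrite expf_neq0.
have -> : 8 / delta / T%:R = 2 * (T%:R * delta / 4)^-1.
  by field; rewrite !gt_eqF.
(* By [L + 1 <= 2 ^ L] the exponential decay is weakened to [1 / (L + 1)], enough for an error of
   order [1 / T]. *)
rewrite ler_wpM2l //; apply: (@le_trans _ _ L.+1%:R^-1).
  by rewrite exprVn lef_pV2 ?posrE ?exprn_gt0 // -natrX ler_nat ltn_expl.
by rewrite lef_pV2 ?posrE ?ltW //; lra.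
Qed.
End Achievability.

(** * Codes with time-shared levels *)

Section Region.
Variables (R : realType) (d : measure_display) (Omega : measurableType d)
  (P : probability Omega R) (q : nat) (N1 N2 : {RV P >-> nat}).
Hypotheses (hN1 : forall w, (N1 w <= q)%N) (hN2 : forall w, (N2 w <= q)%N).

Lemma bc_error1_ge0 T M1 M2 (c : bc_code _ _ _ T M1 M2) :
  0 <= bc_error1 (leb_channel (q := q) N1 N2) c.
Proof.
rewrite bc_error1E // -(@product_mean_cst R T q (fun=> law N1) 0) => [|_]; last first.
  exact: law_dist.
by apply: ler_product_mean => [_|n]; [exact: law_dist|rewrite mulr_ge0 ?invr_ge0].
Qed.

Lemma bc_error2_ge0 T M1 M2 (c : bc_code _ _ _ T M1 M2) :
  0 <= bc_error2 (leb_channel (q := q) N1 N2) c.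
Proof.
rewrite bc_error2E // -(@product_mean_cst R T q (fun=> law N2) 0) => [|_]; last first.
  exact: law_dist.
by apply: ler_product_mean => [_|n]; [exact: law_dist|rewrite mulr_ge0 ?invr_ge0].
Qed.

(** The margin [delta] is asked of positive rates only, because a rate 0 may leave no room for
    it. *)
Lemma achievable_time_shared_levels (a : 'I_q -> R) (r1 r2 delta : R) :
  (forall j, 0 <= a j <= 1) -> 0 <= r1 -> 0 <= r2 -> 0 < delta ->
  (0 < r1 -> r1 + delta <= \sum_j a j * tail_prob N1 j.+1) ->
  (0 < r2 -> r2 + delta <= \sum_j (1 - a j) * tail_prob N2 j.+1) ->
  bc_achievable (leb_channel (q := q) N1 N2) (r1, r2).
Proof.
move=> a01 r10 r20 d0 h1 h2; split=> //=.
have [p1P p2P] := (law_dist hN1, law_dist hN2).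
pose err T := error_rate q delta / T%:R.
have codes T : exists c : bc_code {ffun 'I_q -> bool} _ _ T
    (num_messages T r1) (num_messages T r2),
    q%:R + 1 <= T%:R * delta / 4 ->
    bc_error1 (leb_channel N1 N2) c <= err T /\
    bc_error2 (leb_channel N1 N2) c <= err T.
  have i1 := Ordinal (num_messages_gt0 T r1); have i2 := Ordinal (num_messages_gt0 T r2).
  pose s j := Num.truncn (a j * T%:R).
  have sT j : (s j)%:R <= a j * T%:R < (s j).+1%:R.
    by apply: truncn_itv; rewrite mulr_ge0 //; case/andP: (a01 j).
  have sleT j : (s j <= T)%N.
    rewrite -(ler_nat R); have /andP[le _] := sT j; apply: (le_trans le).
    by rewrite ler_piMl //; case/andP: (a01 j).
  pose A : {set 'I_T * 'I_q} := [set c : 'I_T * 'I_q | (c.1 < s c.2)%N]%SET.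
  have [hT|hT] := leP (q%:R + 1) (T%:R * delta / 4); last first.
    (* Blocks too short for the error bound get an arbitrary code; they do not affect the limit. *)
    by exists (layered_code A (fun=> [ffun=> false]) (fun=> [ffun=> false]) i1 i2).
  have F01 (p : 'I_q.+1 -> R) j : prob_dist p -> 0 <= tail p j <= 1.
    move=> pP; rewrite tail_ge0 //=; case: pP => p0 <-; rewrite /tail big_mkcond.
    by apply: ler_sum => k _; case: ifP.
  have cnt j : \sum_(t < T | (t < s j)%N) (1 : R) = (s j)%:R.
    by rewrite -(@big_ord_widen _ _ _ (s j) T (fun=> 1)) // sumr_const card_ord.
  have mA (p : 'I_q.+1 -> R) : \sum_(c in A) tail p c.2.+1 =
      \sum_(j < q) (s j)%:R * tail p j.+1.
    rewrite (eq_bigl (fun c : 'I_T * 'I_q => (c.1 < s c.2)%N)) => [|c]; last by rewrite inE.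
    rewrite -(pair_big_dep xpredT (fun (t : 'I_T) (j : 'I_q) => (t < s j)%N)
      (fun _ j => tail p j.+1)) /= (exchange_big_dep predT) //=.
    by apply: eq_bigr => j _; rewrite -cnt mulr_suml; under [RHS]eq_bigr do rewrite mul1r.
  have mC (p : 'I_q.+1 -> R) : \sum_(c in ~: A) tail p c.2.+1 =
      \sum_(j < q) (T%:R - (s j)%:R) * tail p j.+1.
    under [RHS]eq_bigr do rewrite mulrBl.
    rewrite sumrB -mA; apply/(canRL (addrK _)).
    have -> : \sum_(j < q) T%:R * tail p j.+1 = \sum_(c : 'I_T * 'I_q) tail p c.2.+1.
      rewrite -(pair_big xpredT xpredT (fun (_ : 'I_T) (j : 'I_q) => tail p j.+1)) /=.
      by rewrite sumr_const card_ord -[RHS]mulr_natl mulr_sumr.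
    rewrite [RHS](bigID (mem A)) /= addrC; congr (_ + _).
    by apply: eq_bigl => c; rewrite inE.
  have [|C1 HC1] := ambiguity_rate p1P (A := A) r10 d0 hT.
    move=> /h1 {}h1; rewrite mA lerBlDr.
    apply: (@le_trans _ _ (\sum_j (T%:R * (a j * tail_prob N1 j.+1)))).
      by rewrite -mulr_sumr ler_wpM2l.
    (* Rounding [a j * T] down loses less than one slot per level, hence at most [q] in all, the
       loss allowed for in [ambiguity_rate]. For message 2 rounding down can only add cells. *)
    rewrite (_ : q%:R = \sum_(j < q) 1); last by rewrite sumr_const card_ord.
    rewrite -big_split /=; apply: ler_sum => j _; rewrite -(tail_law _ hN1).
    have /andP[F0 F1] := F01 _ j.+1 p1P; have /andP[_ s1] := sT j.
    rewrite -natr1 in s1.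
    have := ler_wpM2r F0 (ltW s1); lra.
  have [|C2 HC2] := ambiguity_rate p2P (A := ~: A) r20 d0 hT.
    move=> /h2 {}h2; rewrite mC lerBlDr.
    apply: (@le_trans _ _ (\sum_j (T%:R * ((1 - a j) * tail_prob N2 j.+1)))).
      by rewrite -mulr_sumr ler_wpM2l.
    rewrite -[leLHS]addr0 lerD //; apply: ler_sum => j _; rewrite -(tail_law _ hN2).
    have /andP[F0 _] := F01 _ j.+1 p2P; have /andP[s1 _] := sT j.
    have := ler_wpM2r F0 s1; lra.
  exists (layered_code A C1 C2 i1 i2) => _; split.
    exact: le_trans (layered_code_error1 _ _ _ _ _ _ _) HC1.
  exact: le_trans (layered_code_error2 _ _ _ _ _ _ _) HC2.
exists (fun T => projT1 (cid (codes T))).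
have near_large : \forall T \near \oo, q%:R + 1 <= T%:R * delta / 4.
  near=> T; rewrite -mulrA -ler_pdivrMr ?divr_gt0 //.
  by near: T; exact: nbhs_infty_ger.
have err0 : err T @[T --> \oo] --> 0.
  rewrite -[X in _ --> X](mulr0 (error_rate q delta)); apply: cvgMr.
  by apply/gtr0_cvgV0; [near=> T; rewrite ltr0n; near: T; exact: nbhs_infty_gt|exact: cvgr_idn].
split; apply: (squeeze_cvgr _ (cvg_cst 0) err0); near=> T.
  rewrite bc_error1_ge0 /=; have [] := projT2 (cid (codes T)) _ => //.
  by near: T.
rewrite bc_error2_ge0 /=; have [] := projT2 (cid (codes T)) _ => //.
by near: T.
Unshelve. all: by end_near.
Qed.
End Region.

(** * The capacity region *)

Section Main.
Variables (R : realType) (d : measure_display) (Omega : measurableType d)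
  (P : probability Omega R) (q : nat).
Implicit Types N : {RV P >-> nat}.

Lemma bc_achievable_swap N1 N2 r :
  bc_achievable (leb_channel (q := q) N1 N2) r ->
  bc_achievable (leb_channel (q := q) N2 N1) (r.2, r.1).
Proof.
case=> r1 r2 [c [e1 e2]]; split=> //; exists (fun T => swap_code (c T)); split=> /=.
  by rewrite (_ : (fun T => _) = fun T => bc_error2 (leb_channel (q := q) N1 N2) (c T)) //;
    apply/funext => T; rewrite bc_error2_swap.
by rewrite (_ : (fun T => _) = fun T => bc_error1 (leb_channel (q := q) N1 N2) (c T)) //;
  apply/funext => T; rewrite bc_error2_swap.
Qed.

Lemma closure_achievable_half_plane (A : set (R^o * R^o)) (u v z : R) :
  (forall r, A r -> u * r.1 + v * r.2 <= z) ->
  forall r, closure A r -> u * r.1 + v * r.2 <= z.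
Proof.
move=> Az r; pose B := (fun r : R^o * R^o => u * r.1 + v * r.2) @^-1` [set x | x <= z].
have Bcl : closed B.
  apply: preimage_closed; last exact: closed_le.
  move=> x _; apply: cvgD.
    by apply: cvgMr; exact: cvg_fst.
  by apply: cvgMr; exact: cvg_snd.
have /closure_subset : A `<=` B by move=> x /Az.
by rewrite -((closure_id B).1 Bcl) => /(_ r).
Qed.

Lemma sum_iota1 (f : nat -> R) :
  \sum_(n <- index_iota 1 q.+1) f n = \sum_(j < q) f j.+1.
Proof. by rewrite big_add1 big_mkord. Qed.

Lemma tail_prob_ge0 N n : 0 <= tail_prob N n.
Proof. by rewrite fine_ge0. Qed.

Variables (N1 N2 : {RV P >-> nat}).
Hypotheses (hN1 : forall w, (N1 w <= q)%N) (hN2 : forall w, (N2 w <= q)%N).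

Lemma capacity_region_sub_hull :
  bc_capacity_region (leb_channel (q := q) N1 N2) `<=`
  convex_hull (\bigcup_(omega in [set omega : R | 0 <= omega])
                 layered_rates q N1 N2 omega).
Proof.
move=> r capr.
have r10 : 0 <= r.1.
  have := @closure_achievable_half_plane _ (-1) 0 0 _ _ capr.
  rewrite mul0r addr0 mulN1r oppr_le0; apply => x [x1 _ _].
  by rewrite mul0r addr0 mulN1r oppr_le0.
have r20 : 0 <= r.2.
  have := @closure_achievable_half_plane _ 0 (-1) 0 _ _ capr.
  rewrite mul0r add0r mulN1r oppr_le0; apply => x [_ x2 _].
  by rewrite mul0r add0r mulN1r oppr_le0.
have conv1 (w : R) : 0 <= w <= 1 -> r.1 + w * r.2 <=
    \sum_(j < q) Num.max (tail_prob N1 j.+1) (w * tail_prob N2 j.+1).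
  move=> w01; rewrite -[r.1]mul1r.
  apply: closure_achievable_half_plane capr => x ach; rewrite mul1r.
  exact: achievable_support ach.
have conv2 (w : R) : 0 <= w <= 1 -> w * r.1 + r.2 <=
    \sum_(j < q) Num.max (tail_prob N2 j.+1) (w * tail_prob N1 j.+1).
  move=> w01; rewrite -[r.2]mul1r.
  apply: closure_achievable_half_plane capr => x /bc_achievable_swap ach.
  rewrite mul1r addrC.
  exact: (achievable_support hN2 hN1 w01 ach).
have sup (w : R) : 0 <= w ->
    r.1 + w * r.2 <= support_function (index_iota 1 q.+1) (tail_prob N1) (tail_prob N2) w.
  move=> w0; rewrite /support_function sum_iota1.
  have [w1|w1] := leP w 1; first by apply: conv1; rewrite w0.
  (* For [w > 1], the inequality with exchanged receivers is used at weight [w^-1] and multiplied by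
     [w]. *)
  have wgt0 : 0 < w by apply: lt_trans w1.
  have := conv2 w^-1; rewrite invr_ge0 w0 invf_le1 // (ltW w1) => /(_ isT).
  move/(ler_wpM2l w0); rewrite mulrDr mulVKf ?gt_eqF // => /le_trans; apply.
  rewrite mulr_sumr; apply: ler_sum => j _.
  by rewrite maxr_pMr // mulVKf ?gt_eqF // maxC.
have r2F : r.2 <= \sum_(n <- index_iota 1 q.+1) tail_prob N2 n.
  rewrite sum_iota1; have := conv2 0; rewrite lexx ler01 mul0r add0r => /(_ isT).
  move/le_trans; apply; apply: ler_sum => j _.
  by rewrite mul0r max_l // tail_prob_ge0.
have [w [w' [l [a1 [a2 [b1 [b2 [[w0 w0'] /andP[l0 l1] [/andP[a10 a1c] /andP[a20 a2c]]
  [/andP[b10 b1c] /andP[b20 b2c]] [e1 e2]]]]]]]]] :=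
  supported_rates_between_corners (tail_prob_ge0 N1) (tail_prob_ge0 N2) r10 r20 sup r2F.
move=> M [Mconv Msub].
have Ma : M (a1, a2).
  by apply: Msub; exists w => //; split=> //; rewrite big_filter.
have Mb : M (b1, b2).
  by apply: Msub; exists w' => //; split=> //; rewrite big_filter.
have := Mconv (a1, a2) (b1, b2) (Itv01 l0 l1) (mem_set Ma) (mem_set Mb).
rewrite inE; congr (M _); case: (r) e1 e2 => x1 x2 /= -> ->.
by [].
Qed.

(** A set between the hull and the capacity region: the assignment of each layer to one receiver is
    relaxed to a fraction [a j], which makes the set convex. *)
Definition time_shared : set (R^o * R^o) := [set r | [/\ 0 <= r.1, 0 <= r.2 &
  exists a : 'I_q -> R, [/\ forall j, 0 <= a j <= 1,
    r.1 <= \sum_j a j * tail_prob N1 j.+1 &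
    r.2 <= \sum_j (1 - a j) * tail_prob N2 j.+1]]].

Lemma time_shared_sub_capacity :
  time_shared `<=` bc_capacity_region (leb_channel (q := q) N1 N2).
Proof.
move=> r [r10 r20 [a [a01 h1 h2]]] B /nbhs_ballP[e /= e0 eB].
have d0 : 0 < e / 2 by rewrite divr_gt0.
(* Lowering both rates by [e / 2] creates the margin; cutting off at 0 keeps them nonnegative and
   moves each by less than [e]. *)
pose r' : R^o * R^o := (Num.max 0 (r.1 - e / 2), Num.max 0 (r.2 - e / 2)).
exists r'; split.
  apply: (@achievable_time_shared_levels _ _ _ _ _ _ _ hN1 hN2 a _ _ (e / 2)) => //.
  - by rewrite le_max lexx.
  - by rewrite le_max lexx.
  - by rewrite lt_max ltxx /= => /ltW h; rewrite max_r // subrK.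
  - by rewrite lt_max ltxx /= => /ltW h; rewrite max_r // subrK.
have dist (x : R) : 0 <= x -> `|x - Num.max 0 (x - e / 2)| < e.
  by move=> x0; rewrite ltr_norml; have [] := leP 0 (x - e / 2); lra.
by apply: eB; split; apply: dist.
Qed.

Lemma hull_sub_time_shared :
  convex_hull (\bigcup_(omega in [set omega : R | 0 <= omega])
                 layered_rates q N1 N2 omega) `<=` time_shared.
Proof.
apply: smallest_sub.
  move=> [x1 x2] [y1 y2] l /set_mem[/= x10 x20 [a [a01 ax1 ax2]]].
  move=> /set_mem[/= y10 y20 [b [b01 by1 by2]]]; apply/mem_set.
  have [l0 l1] : 0 <= l%:num /\ l%:num <= 1 by split.
  have -> : conv l ((x1, x2) : convex_lmodType (R^o * R^o)%type) (y1, y2) =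
    (l%:num * x1 + (1 - l%:num) * y1, l%:num * x2 + (1 - l%:num) * y2) by [].
  move: (l%:num) l0 l1 => k k0 k1.
  split=> /=.
  - by rewrite addr_ge0 // mulr_ge0 //; lra.
  - by rewrite addr_ge0 // mulr_ge0 //; lra.
  exists (fun j => k * a j + (1 - k) * b j); split.
  - move=> j; have /andP[aj0 aj1] := a01 j; have /andP[bj0 bj1] := b01 j.
    by apply/andP; split; nra.
  - apply: (le_trans (lerD (ler_wpM2l k0 ax1) (ler_wpM2l _ by1))); first by lra.
    rewrite !mulr_sumr -big_split; apply: ler_sum => j _ /=.
    by rewrite le_eqVlt; apply/orP; left; apply/eqP; ring.
  - apply: (le_trans (lerD (ler_wpM2l k0 ax2) (ler_wpM2l _ by2))); first by lra.
    rewrite !mulr_sumr -big_split; apply: ler_sum => j _ /=.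
    by rewrite le_eqVlt; apply/orP; left; apply/eqP; ring.
move=> r [w w0 [r10 r20 h1 h2]].
rewrite /layers1 big_filter big_mkcond sum_iota1 in h1.
rewrite /layers2 big_filter big_mkcond sum_iota1 in h2.
split=> //; exists (fun j : 'I_q =>
  if 0 < tail_prob N1 j.+1 - w * tail_prob N2 j.+1 then 1 else 0); split.
- by move=> j; case: ifP; rewrite lexx ler01.
- apply: (le_trans h1); apply: ler_sum => j _.
  by have [_|_] := ltP 0 (tail_prob N1 j.+1 - _); rewrite ?mul1r ?mul0r.
- apply: (le_trans h2); apply: ler_sum => j _.
  by have [_|_] := ltP 0 (tail_prob N1 j.+1 - _); rewrite ?subrr ?subr0 ?mul1r ?mul0r.
Qed.

End Main.

Theorem theorem2 (R : realType) (d : measure_display)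
    (Omega : measurableType d) (P : probability Omega R) (q : nat)
    (N1 N2 : {RV P >-> nat}) (hq : (1 <= q)%N)
    (hN1 : forall w, (N1 w <= q)%N) (hN2 : forall w, (N2 w <= q)%N) :
  bc_capacity_region (leb_channel (q := q) N1 N2) =
  convex_hull (\bigcup_(omega in [set omega : R | 0 <= omega])
                 layered_rates q N1 N2 omega).
Proof.
apply/seteqP; split; first exact: capacity_region_sub_hull.
apply: subset_trans (time_shared_sub_capacity hN1 hN2).
exact: hull_sub_time_shared.
Qed.
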